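(* Let $k\ge2$ and $l\ge1$ be integers. There is an action of $\mathbb Z\ltimes\mathbb Z[1/k]$, generated by the holomorphic automorphisms $g_\gamma$ and $g$ in the normal form (FG4), on $\mathbb C\times\mathbb H\times\mathcal A\times\mathcal B$, which is compatible with the projection $\mathbb C\times\mathbb H\times\mathcal A\times\mathcal B\to\mathcal A\times\mathcal B$. Let $T\subset\mathcal A\times\mathcal B$ be a connected analytic subspace. The restriction of this action to $\mathbb C\times\mathbb H\times T$ is properly discontinuous if and only if the type is constant on $T$. In this case the quotient space fibers smoothly over $T$.
   Context: $\mathbb H=\{w\in\mathbb C\mid \operatorname{Re} w<0\}$ is the left half plane, with coordinates $(z,w)$ on $\mathbb C\times\mathbb H$. Set $$\mathcal A:=\{(\lambda,a_0)\in\mathbb C^*\times\mathbb C\mid(\lambda-1)a_0=0\},$$ $$\mathcal B:=\{b=(b_l,\dots,b_{lk-1})\in\mathbb C^{lk-l}\mid(b_{lk-k+1},\dots,b_{lk-1})\neq0,\ \gcd\{k,m\mid b_m\neq0\}=1\}.$$ For $b\in\mathcal B$ let $Q(\zeta)=\sum_{m=l}^{lk-1}b_m\zeta^m$. **Normal form (FG4).** For $(\lambda,a_0,b)\in\mathcal A\times\mathcal B$ the automorphisms of $\mathbb C\times\mathbb H$ are $$g_\gamma(z,w)=(z,w+2\pi i),\qquad g(z,w)=(\lambda z+a_0+Q(e^{-w}),kw).$$ They satisfy $g\circ g_\gamma\circ g^{-1}=g_\gamma^k$ and generate a group isomorphic to $\mathbb Z\ltimes\mathbb Z[1/k]$. They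 act on $\mathbb C\times\mathbb H\times\mathcal A\times\mathcal B$ by these formulas on each fibre over a point $(\lambda,a_0,b)\in\mathcal A\times\mathcal B$, leaving $(\lambda,a_0,b)$ fixed. **Type.** The type of $(\lambda,a_0,b)$ (it depends only on $b$) is the tuple $(n_1,\dots,n_t)$ defined inductively as follows, together with integers $k>j_1>j_2>\dots>j_t=1$: $n_1:=\sigma:=\deg Q$ (so $lk-k<\sigma<lk$), $j_1:=\gcd(k,n_1)$; $n_\alpha:=\max\{i<n_{\alpha-1}\mid b_i\neq0,\ \gcd(j_{\alpha-1},i)<j_{\alpha-1}\}$, $j_\alpha:=\gcd(k,n_1,\dots,n_\alpha)=\gcd(j_{\alpha-1},n_\alpha)$; stopping when $j_t=1$. *)

(* Defs.v *)
From HB Require Import structures.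
From mathcomp Require Import all_boot all_order all_algebra.
From mathcomp Require Import all_classical all_reals all_analysis.
From mathcomp Require Import complex.
Set Implicit Arguments.
Unset Strict Implicit.
Unset Printing Implicit Defensive.
Import Order.TTheory GRing.Theory Num.Theory numFieldNormedType.Exports.
Local Open Scope ring_scope.
Local Open Scope classical_set_scope.

(* The packing as a numeric field gives these numbers, their products and    *)
(* their row vectors a normed-space structure over [CC R] itself, so that     *)
(* [differentiable] means complex (Frechet) differentiable; on an open set    *)
(* this is holomorphy.                                                        *)
Definition CC (R : realType) : numClosedFieldType := R[i].

Definition cexp (R : realType) (w : CC R) : CC R :=
  ((expR (complex.Re w) * cos (complex.Im w)) +i*
   (expR (complex.Re w) * sin (complex.Im w)))%C.

Section ComplexSpaces.
Variable R : realType.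
Local Notation C := (CC R).
Implicit Types V W : normedModType C.

Definition holo_at V W (f : V -> W) (p : V) : Prop :=
  \forall q \near p, differentiable f q.

(* Holomorphic maps on a subset, with values in the ambient vector space. *)
Definition holo_on V W (S : set V) (f : V -> W) : Prop :=
  forall p, S p -> exists2 F : V -> W,
    holo_at F p & \forall q \near p, S q -> f q = F q.

(* Ideals of germs at p are represented by the functions on the whole space   *)
(* whose germ at p belongs to the ideal.                                      *)
Definition germ_ideal V (F : set (V -> C)) (p : V) : set (V -> C) :=
  [set h | exists (n : nat) (f c : 'I_n -> V -> C),
    (forall i, F (f i) /\ holo_at (c i) p) /\
    \forall q \near p, h q = \sum_(i < n) c i q * f i q].

(* A (possibly non-reduced) embedded complex space: a set of points, and at   *)
(* each of them the ideal of germs vanishing on the space. The structure      *)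
(* sheaf has at p the stalk (germs of holomorphic functions) / [idl p];       *)
(* [idl p] is meaningless when p is not a point.                              *)
Record cspace V := CSpace { pts : set V ; idl : V -> set (V -> C) }.

(* Locally closed analytic subspaces of V. *)
Definition analytic_space V (X : cspace V) : Prop :=
  forall p, pts X p -> exists (n : nat) (f : 'I_n -> V -> C),
    \forall q \near p,
      [/\ forall i, differentiable (f i) q,
          pts X q <-> (forall i, f i q = 0) &
          pts X q -> idl X q = germ_ideal (range f) q].

Definition open_part V (X : cspace V) (O : set V) : cspace V :=
  CSpace (pts X `&` O) (idl X).

Definition prod_space V W (D : set V) (X : cspace W) : cspace (V * W)%type :=
  CSpace [set p | D p.1 /\ pts X p.2]
    (fun p => germ_ideal [set f | exists2 h, idl X p.2 h & f = h \o snd] p).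

(* Pull-back of germs along psi is a well-defined isomorphism from the stalk  *)
(* of Y at [psi p] to the stalk of X at p.                                    *)
Definition stalk_iso V W (X : cspace V) (Y : cspace W) (psi : V -> W) (p : V)
    : Prop :=
  [/\ holo_at psi p,
      forall h : W -> C, holo_at h (psi p) ->
        (idl Y (psi p) h <-> idl X p (h \o psi)) &
      forall f : V -> C, holo_at f p -> exists2 h : W -> C,
        holo_at h (psi p) & idl X p (fun q => f q - h (psi q))].

End ComplexSpaces.

Section GroupActions.
Variables (G : Type) (E : topologicalType).

Definition prop_discontinuous (Gam : set G) (act : G -> E -> E) (S : set E)
    : Prop :=
  forall K : set E, K `<=` S -> compact K ->
    finite_set [set x | Gam x /\ (act x @` K) `&` K !=set0].

(* X, with the projection pr (only its values on S matter), is the orbit     *)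
(* space of the invariant subset S with the quotient topology.               *)
Definition is_orbit_space (Gam : set G) (act : G -> E -> E) (S : set E)
    (X : topologicalType) (pr : E -> X) : Prop :=
  [/\ pr @` S = setT,
      forall p q, S p -> S q ->
        (pr p = pr q <-> exists2 x, Gam x & act x p = q) &
      forall U : set X, open U <->
        exists2 O : set E, open O & S `&` pr @^-1` U = S `&` O].

End GroupActions.

(* The complex space Y is given in F x P over T in P, and pr : Y -> X is a    *)
(* quotient by automorphisms of Y over T; the complex structure of X is the   *)
(* one that makes pr a local isomorphism. X -> T is smooth: around each of    *)
(* its points, X is isomorphic over T to a product of an open subset D of F   *)
(* and an open part of T. The isomorphism is pr \o psi, with psi a            *)
(* holomorphic map over T that is an isomorphism on stalks and pr \o psi a    *)
(* homeomorphism onto an open neighbourhood of the point.                     *)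
Definition fibers_smoothly (R : realType) (F P : normedModType (CC R))
    (T : cspace P) (Y : cspace (F * P)%type) (X : topologicalType)
    (pr : (F * P)%type -> X) : Prop :=
  forall x : X, exists (D : set F) (O : set P) (psi : F * P -> F * P),
    let U := prod_space D (open_part T O) in
    [/\ open D /\ open O,
        forall p, pts U p ->
          [/\ pts Y (psi p), \forall q \near p, (psi q).2 = q.2 &
              stalk_iso U Y psi p],
        ((pr \o psi) @` pts U) x,
        set_inj (pts U) (pr \o psi) /\ {within pts U, continuous (pr \o psi)} &
        forall W : set (F * P), open W -> open ((pr \o psi) @` (pts U `&` W))].

(* The group Z |x Z[1/k], as a set of pairs (n, a) with                       *)
(* (n, a) (m, b) = (n + m, a + k^n b); so (1, 0) (0, 1) (1, 0)^-1 = (0, k).   *)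
Section SemidirectProduct.
Variable k : nat.

Definition ZZk : set (int * rat) :=
  [set x | exists m : nat, x.2 * k%:R ^+ m \is a Num.int].

Definition ZZk_mul (x y : int * rat) : int * rat :=
  (x.1 + y.1, x.2 + (k%:R : rat) ^ x.1 * y.2).

Definition ZZk_one : int * rat := (0, 0).

Definition is_ZZk_action (E : Type) (S : set E) (act : int * rat -> E -> E)
    : Prop :=
  [/\ forall x p, ZZk x -> S p -> S (act x p),
      forall p, S p -> act ZZk_one p = p &
      forall x y p, ZZk x -> ZZk y -> S p ->
        act (ZZk_mul x y) p = act x (act y p)].

End SemidirectProduct.

Section NormalForm.
Variables (R : realType) (k l : nat).
Local Notation C := (CC R).

(* Parameters ((lambda, a_0), b); the entry of index i of b is b_(l+i). *)
Definition param : normedModType C := (C * C * 'rV[C]_(l * k - l))%type.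
(* Points ((z, w), parameter). *)
Definition ambient : normedModType C := (C * C * param)%type.

Definition Qpoly (b : 'rV[C]_(l * k - l)) : {poly C} :=
  \sum_(i < l * k - l) b 0 i *: 'X^(l + i).

Definition setA : set (C * C) := [set a | a.1 != 0 /\ (a.1 - 1) * a.2 = 0].

Definition setB : set 'rV[C]_(l * k - l) := [set b |
  (exists2 m : nat, (l * k - k < m < l * k)%N & (Qpoly b)`_m != 0) /\
  \big[gcdn/k]_(m < l * k | (Qpoly b)`_m != 0) (m : nat) = 1%N].

Definition setAB : set param := [set t | setA t.1 /\ setB t.2].

Definition half_plane : set (C * C) := [set u | complex.Re u.2 < 0].

Definition fibered_over (T : set param) : set ambient :=
  [set p | half_plane p.1 /\ T p.2].

Definition g_gamma (p : ambient) : ambient :=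
  ((p.1.1, p.1.2 + (0 +i* (2 * pi))%C), p.2).

Definition g_auto (p : ambient) : ambient :=
  ((p.2.1.1 * p.1.1 + p.2.1.2 + (Qpoly p.2.2).[cexp (- p.1.2)],
    k%:R * p.1.2), p.2).

(* [type_tail fuel Q j n] lists n_(alpha+1), ..., n_t from j = j_alpha and     *)
(* n = n_alpha. As j strictly decreases on setB and j_1 < k, fuel k suffices. *)
Fixpoint type_tail (fuel : nat) (Q : {poly C}) (j n : nat) : seq nat :=
  if fuel is fuel'.+1 then
    if j == 1%N then [::] else
    let n' := (\max_(i < n | (Q`_i != 0)%R && (gcdn j i < j)) i)%N in
    n' :: type_tail fuel' Q (gcdn j n') n'
  else [::].

Definition type_of (t : param) : seq nat :=
  let Q := Qpoly t.2 in
  let n1 := (size Q).-1 in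
  n1 :: type_tail k Q (gcdn k n1) n1.

Definition subspace_AB (T : cspace param) : Prop :=
  analytic_space T /\
  forall t, pts T t ->
    setAB t /\ idl T t (fun s : param => (s.1.1 - 1) * s.1.2).

End NormalForm.

(* Main.v *)
Require Import Defs.
From HB Require Import structures.
From mathcomp Require Import all_boot all_order all_algebra.
From mathcomp Require Import all_classical all_reals all_analysis.
From mathcomp Require Import complex ring lra zify.
Set Implicit Arguments.
Unset Strict Implicit.
Unset Printing Implicit Defensive.
Import Order.TTheory GRing.Theory Num.Theory numFieldNormedType.Exports.
Local Open Scope ring_scope.
Local Open Scope classical_set_scope.

(** Write [y = exp(-w)]. Conjugation by the divergent series
    [z + sum_i lambda^-(i+1) Q(exp(-k^i w))] turns [g] into an affine map, and the
    differences of its truncations give a closed formula for the whole action.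
    Only the translations by [a = c / k^(n+1)], with [k] not dividing [c], can
    fail to be properly discontinuous; such a translation moves [z] by
    [lambda^-(n+1) F(y)] with [F] a polynomial, whose terms of index [n] are
    [b_m (1 - exp(-2 pi i m c / k)) y^(m k^n)]. As [deg Q < l k], the nonzero one
    with the largest [m] beats all the terms of lower index when [n] is large;
    that [m] is the largest exponent of [Q] not divisible by [d = k / gcd(k, c)],
    and the type amounts to the collection of these exponents for all [d].

    If they are constant, [F(y)] tends to infinity uniformly on compact sets.
    If one of them jumps at a parameter [t0], then near [t0] there are [n -> oo]
    for which [F] has a root in a fixed annulus, and each root is a point that
    returns exactly to the fibre coordinate [z] it started from. The existence
    of the root replaces Rouche's theorem by Jensen's formula, discretised over
    roots of unity: without roots in the annulus, the mean of [log |F|] on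
    circles would be affine in the logarithm of the radius.

    The group acts freely, so that a properly discontinuous action has small
    slices; through them the quotient inherits the product structure of the
    total space. *)

(** * The modulus and the exponential *)

Section ComplexModulus.
Variable R : realType.
Local Notation C := (CC R).
Implicit Types x y : C.

(* [`|x|] lies in [CC R] itself, which is only partially ordered. *)
Definition cabs x : R := complex.Re `|x|.

Lemma cabsE x : `|x| = (cabs x)%:C%C.
Proof. by rewrite /cabs RRe_real// normr_real. Qed.

Lemma cabs_ge0 x : 0 <= cabs x.
Proof. by rewrite -lecR -cabsE normr_ge0. Qed.

Lemma cabs_inj x (r : R) : `|x| = r%:C%C -> cabs x = r.
Proof. by rewrite cabsE => /complexI. Qed.

Lemma cabs0 : cabs 0 = 0.
Proof. by apply: cabs_inj; rewrite normr0. Qed.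

Lemma cabs1 : cabs 1 = 1.
Proof. by apply: cabs_inj; rewrite normr1. Qed.

Lemma cabsM x y : cabs (x * y) = cabs x * cabs y.
Proof. by apply: cabs_inj; rewrite normrM !cabsE rmorphM. Qed.

Lemma cabsV x : cabs x^-1 = (cabs x)^-1.
Proof. by apply: cabs_inj; rewrite normfV cabsE fmorphV. Qed.

Lemma cabsX x n : cabs (x ^+ n) = cabs x ^+ n.
Proof. by apply: cabs_inj; rewrite normrX cabsE rmorphXn. Qed.

Lemma cabsN x : cabs (- x) = cabs x.
Proof. by rewrite /cabs normrN. Qed.

Lemma cabs_distC x y : cabs (x - y) = cabs (y - x).
Proof. by rewrite /cabs distrC. Qed.

Lemma cabsD x y : cabs (x + y) <= cabs x + cabs y.
Proof. by rewrite -lecR rmorphD/= -!cabsE ler_normD. Qed.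

Lemma cabsB x y : cabs x - cabs y <= cabs (x - y).
Proof. by rewrite -lecR rmorphB/= -!cabsE lerB_dist. Qed.

Lemma cabs_eq0 x : (cabs x == 0) = (x == 0).
Proof.
rewrite -[x == 0]normr_eq0 cabsE; apply/esym; exact: (inj_eq (@complexI R) _ 0).
Qed.

Lemma cabs_gt0 x : (0 < cabs x) = (x != 0).
Proof. by rewrite lt_def cabs_ge0 andbT cabs_eq0. Qed.

Lemma cabs_real (r : R) : cabs r%:C%C = `|r|.
Proof. by apply: cabs_inj; rewrite normc_def/= expr0n addr0 sqrtr_sqr. Qed.

Lemma cabs_sum I (r : seq I) (P : pred I) (F : I -> C) :
  cabs (\sum_(i <- r | P i) F i) <= \sum_(i <- r | P i) cabs (F i).
Proof.
elim/big_ind2: _ => [|x a y b xa yb|//]; first by rewrite cabs0.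
exact: le_trans (cabsD _ _) (lerD _ _).
Qed.

Lemma cabs_prod I (r : seq I) (P : pred I) (F : I -> C) :
  cabs (\prod_(i <- r | P i) F i) = \prod_(i <- r | P i) cabs (F i).
Proof. exact: (big_morph _ cabsM cabs1). Qed.

Lemma cabs_sqr x : cabs x ^+ 2 = complex.Re x ^+ 2 + complex.Im x ^+ 2.
Proof.
apply: complexI; rewrite rmorphXn/= -cabsE.
exact/esym/add_Re2_Im2.
Qed.

Lemma cabs_Re x : `|complex.Re x| <= cabs x.
Proof. by rewrite -lecR -cabsE normc_ge_Re. Qed.

Lemma cabs_Im x : `|complex.Im x| <= cabs x.
Proof.
rewrite -[leLHS]sqrtr_sqr -[leRHS]ger0_norm ?cabs_ge0// -[leRHS]sqrtr_sqr.
by rewrite ler_wsqrtr// cabs_sqr lerDr sqr_ge0.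
Qed.

Lemma cabs_le_ReIm x : cabs x <= `|complex.Re x| + `|complex.Im x|.
Proof.
have -> : x = (complex.Re x)%:C%C + 'i%C * (complex.Im x)%:C%C by rewrite -complexE.
apply: le_trans (cabsD _ _) _; rewrite cabsM cabs_real cabs_real.
suff -> : cabs 'i%C = 1 by rewrite mul1r /= !(mul0r, mul1r, subr0, addr0, add0r).
by apply: cabs_inj; rewrite normc_def/= expr0n expr1n add0r sqrtr1.
Qed.

(** Balls in [CC R] have radii in [CC R]; a positive element there is real, so real radii
    suffice. *)
Lemma nbhs_cabsP x (A : set C) :
  nbhs x A <-> exists2 e : R, 0 < e & forall y, cabs (x - y) < e -> A y.
Proof.
split=> [/nbhs_ballP[e /= e0 eA]|[e e0 eA]].
  have ee : e = (complex.Re e)%:C%C by rewrite RRe_real// gtr0_real.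
  exists (complex.Re e) => [|y xy]; first by rewrite -ltcR -ee.
  by apply: eA; rewrite -ball_normE/= ee cabsE ltcR.
apply/nbhs_ballP; exists e%:C%C => /=; first by rewrite ltcR.
by move=> y; rewrite -ball_normE/= cabsE ltcR; exact: eA.
Qed.

Lemma lipschitz_continuous (f : C -> R) :
  (forall x y, `|f x - f y| <= cabs (x - y)) -> continuous f.
Proof.
move=> fl x A /nbhs_ballP[e /= e0 eA]; apply/nbhs_cabsP; exists e => // y xy.
by apply: eA; rewrite -ball_normE/=; exact: le_lt_trans xy.
Qed.

Lemma continuous_cabs : continuous cabs.
Proof.
apply: lipschitz_continuous => x y; rewrite ler_norml cabsB andbT.
by rewrite lerNl opprB cabs_distC cabsB.
Qed.

Lemma continuous_Re : continuous (fun x : C => complex.Re x).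
Proof.
apply: lipschitz_continuous => x y.
suff -> : complex.Re x - complex.Re y = complex.Re (x - y) by exact: cabs_Re.
by case: x y => [a b] [c d].
Qed.

Lemma continuous_mkC : continuous (fun u : R * R => (u.1 +i* u.2)%C : C).
Proof.
move=> -[a b] A /nbhs_cabsP[e e0 eA].
have e20 : 0 < e / 2 by rewrite divr_gt0.
exists (ball a (e / 2), ball b (e / 2)).
  by split; apply: nbhsx_ballx.
move=> [c d] /=; rewrite -!ball_normE/= => -[ac bd]; apply: eA.
apply: le_lt_trans (cabs_le_ReIm _) _ => /=.
by rewrite (splitr e) ltrD.
Qed.

End ComplexModulus.

Section ComplexExponential.
Variable R : realType.
Local Notation C := (CC R).
Implicit Types x y w : C.

Lemma cexp0 : cexp (0 : C) = 1.
Proof. by rewrite /cexp /= expR0 cos0 sin0 mulr0 mulr1. Qed.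

Lemma cexpD x y : cexp (x + y) = cexp x * cexp y.
Proof.
case: x y => [a b] [c d]; rewrite /cexp /= expRD cosD sinD.
by apply/eqP; rewrite eq_complex/=; apply/andP; split; apply/eqP; ring.
Qed.

Lemma cexpN x : cexp (- x) * cexp x = 1.
Proof. by rewrite -cexpD addNr cexp0. Qed.

Lemma cexp_neq0 x : cexp x != 0.
Proof. by apply: contra_eq_neq (cexpN x) => ->; rewrite mulr0 eq_sym oner_eq0. Qed.

Lemma cexpMn n x : cexp (n%:R * x) = cexp x ^+ n.
Proof.
elim: n => [|n IHn]; first by rewrite mul0r cexp0.
by rewrite -natr1 mulrDl mul1r cexpD IHn exprSr.
Qed.

Lemma cabs_cexp x : cabs (cexp x) = expR (complex.Re x).
Proof.
apply/eqP; rewrite -(eqrXn2 (ltn0Sn 1)) ?cabs_ge0 ?expR_ge0//; apply/eqP.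
by rewrite cabs_sqr/= !exprMn -mulrDr cos2Dsin2 mulr1.
Qed.

Lemma Re_addC x y : complex.Re (x + y) = complex.Re x + complex.Re y.
Proof. by case: x y => [a b] [c d]. Qed.

Lemma Re_oppC x : complex.Re (- x) = - complex.Re x.
Proof. by case: x. Qed.

Lemma Re_natM n x : complex.Re (n%:R * x) = n%:R * complex.Re x.
Proof.
elim: n => [|n IHn]; first by rewrite !mul0r.
by rewrite -!natr1 !mulrDl Re_addC IHn !mul1r.
Qed.

Lemma cos_sin_surj (u v : R) : u ^+ 2 + v ^+ 2 = 1 ->
  exists2 th : R, `|th| <= pi & cos th = u /\ sin th = v.
Proof.
move=> uv1.
have u1 : -1 <= u <= 1 by apply/andP; split; nra.
have ua : (u \in `[(-1), 1])%R by rewrite in_itv.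
have sv : sin (acos u) = `|v|.
  by rewrite sin_acos// -uv1 addrAC subrr add0r sqrtr_sqr.
have ap : `|acos u| <= pi by rewrite ger0_norm ?acos_ge0 ?acos_lepi.
have [v0|v0] := leP 0 v.
  by exists (acos u) => //; rewrite acosK// sv ger0_norm.
exists (- acos u); first by rewrite normrN.
by rewrite cosN sinN acosK// sv ltr0_norm ?opprK.
Qed.

(** The bound on the imaginary part will keep the returning points in a compact box. *)
Lemma cexp_surj y : y != 0 ->
  exists w, [/\ cexp w = y, complex.Re w = ln (cabs y) & `|complex.Im w| <= pi].
Proof.
move=> y0; have cy : 0 < cabs y by rewrite cabs_gt0.
have [|th thp [cth sth]] :=
  @cos_sin_surj (complex.Re y / cabs y) (complex.Im y / cabs y).
  by rewrite !expr_div_n -mulrDl -cabs_sqr divff// expf_neq0// gt_eqF.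
exists (ln (cabs y) +i* th)%C; split=> //.
rewrite /cexp /= lnK ?posrE// cth sth.
rewrite ![_ / cabs y]mulrC !mulVKf ?gt_eqF//.
by case: y {y0 cy cth sth}.
Qed.

Definition tpi : C := (0 +i* (2 * pi))%C.

Lemma tpiM (r : R) : r%:C%C * tpi = (0 +i* (r * (2 * pi)))%C.
Proof. by rewrite /tpi; simpc. Qed.

Lemma cexp_tpi_nat (n : nat) : cexp (n%:R * tpi) = 1.
Proof.
rewrite cexpMn /cexp /= expR0 !mul1r mulr_natl -[pi *+ 2]add0r cosD2pi sinD2pi.
by rewrite cos0 sin0 expr1n.
Qed.

Lemma cexp_tpi_int (m : int) : cexp (m%:~R * tpi) = 1.
Proof.
case: m => n; first exact: cexp_tpi_nat.
have := cexpN (n.+1%:R * tpi); rewrite cexp_tpi_nat mulr1.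
by rewrite NegzE mulrNz mulNr.
Qed.

(** The real part is [1 - 2 sin(r pi)^2], and the sine is positive on [(0, pi)]. *)
Lemma cexp_tpi_neq1 (r : R) : 0 < r < 1 -> cexp (r%:C%C * tpi) != 1.
Proof.
move=> /andP[r0 r1]; rewrite tpiM /cexp /= expR0 !mul1r.
apply/eqP => -[c1 _]; move: c1.
have -> : r * (2 * pi) = (r * pi) *+ 2 :> R by rewrite -mulr_natr; ring.
rewrite cos_mulr2n => c1.
have := cos2Dsin2 (r * pi).
have : 0 < sin (r * pi).
  by apply: sin_gt0_pi; rewrite mulr_gt0 ?pi_gt0//= gtr_pMl ?pi_gt0.
by rewrite -mulr_natr in c1; nra.
Qed.

End ComplexExponential.

Section ExponentialDerivative.
Variable R : realType.
Implicit Types y : R.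

Lemma abs_sin_le y : `|sin y| <= `|y|.
Proof.
wlog y0 : y / 0 <= y => [h|].
  have [/h//|/ltW y0] := leP 0 y.
  by rewrite -normrN -sinN -[leRHS]normrN h// oppr_ge0.
have [c _ e] := @MVT_segment R (@sin R) (@cos R) 0 y y0 (fun x _ => is_derive_sin x)
  (@continuous_subspaceT _ _ _ _ (@continuous_sin R)).
rewrite sin0 !subr0 in e; rewrite e normrM ler_piMl//; exact: cos_max.
Qed.

Lemma abs_cos_sub1_le y : `|cos y - 1| <= y ^+ 2.
Proof.
have ye : y = (y / 2) *+ 2 by rewrite -mulr_natr divfK.
have -> : cos y - 1 = - (2 * sin (y / 2) ^+ 2).
  by rewrite {1}ye cos_mulr2n; have := cos2Dsin2 (y / 2); lra.
rewrite normrN normrM ger0_norm// normrX.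
have := abs_sin_le (y / 2); rewrite normrM [ `|2^-1|]ger0_norm ?invr_ge0//.
rewrite -[y ^+ 2]real_normK ?num_real//.
by move=> h; have := normr_ge0 (sin (y / 2)); have := normr_ge0 y; nra.
Qed.

Lemma abs_sin_sub_le y : `|y| <= 1 -> `|sin y - y| <= y ^+ 2.
Proof.
wlog y0 : y / 0 <= y => [h|].
  have [/h//|/ltW y0] := leP 0 y.
  move=> y1; have := h (- y); rewrite oppr_ge0 normrN sinN sqrrN => /(_ y0 y1).
  by rewrite -opprD normrN.
move=> y1.
have [c] := @MVT_segment R (@sin R) (@cos R) 0 y y0 (fun x _ => is_derive_sin x)
  (@continuous_subspaceT _ _ _ _ (@continuous_sin R)).
rewrite in_itv/= sin0 !subr0 => /andP[c0 cy] ->.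
have -> : cos c * y - y = (cos c - 1) * y by ring.
rewrite normrM [ `|y|]ger0_norm// expr2 ler_wpM2r//.
apply: le_trans (abs_cos_sub1_le c) _.
by rewrite ger0_norm in y1 => //; nra.
Qed.

(** Convexity at [y] bounds [exp y] below by [1 + y]; at [-y] it gives [(1 - y) exp y <= 1]. *)
Lemma abs_expR_sub_le y : `|y| <= 2^-1 -> `|expR y - 1 - y| <= 2 * y ^+ 2.
Proof.
rewrite ler_norml => /andP[y1 y2].
have h1 := expR_ge1Dx y.
have h2 := expR_ge1Dx (- y).
have h3 : expR (- y) * expR y = 1 by rewrite -expRD addNr expR0.
have h4 := expR_gt0 y.
rewrite ger0_norm; last by lra.
have : (1 - y) * expR y <= 1 by rewrite -h3 ler_wpM2r ?expR_ge0//; lra.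
nra.
Qed.

Lemma cabs_cexp_sub_le (h : CC R) : cabs h <= 2^-1 ->
  cabs (cexp h - 1 - h) <= 10 * cabs h ^+ 2.
Proof.
case: h => a b h2.
have a2 : `|a| <= 2^-1 by apply: le_trans (cabs_Re (a +i* b)%C) h2.
have b2 : `|b| <= 2^-1 by apply: le_trans (cabs_Im (a +i* b)%C) h2.
apply: le_trans (cabs_le_ReIm _) _; rewrite cabs_sqr /cexp /=.
have ha := abs_expR_sub_le a2.
have b1 : `|b| <= 1 by lra.
have hs := abs_sin_sub_le b1; have hc := abs_cos_sub1_le b.
have e2 : expR a <= 2.
  by move: a2 ha; rewrite !ler_norml => /andP[? ?] /andP[? ?]; nra.
have e0 := expR_ge0 a.
set E := expR a in ha e2 e0 *; set s := sin b in hs *; set c := cos b in hc *.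
have eb u v : `|u| <= v -> `|E * u| <= 2 * v.
  by move=> uv; rewrite normrM ler_pM// ger0_norm.
have Ec := eb _ _ hc; have Es := eb _ _ hs.
have -> : E * c - 1 - a = (E - 1 - a) + E * (c - 1) by ring.
have -> : E * s - 0 - b = E * (s - b) + ((E - 1 - a) * b + a * b) by ring.
have hb : `|(E - 1 - a) * b| <= 2 * a ^+ 2.
  by rewrite normrM -[leRHS]mulr1 ler_pM.
have hab : `|a * b| <= a ^+ 2 + b ^+ 2.
  by rewrite ler_norml; apply/andP; split; nra.
have := ler_normD (E - 1 - a) (E * (c - 1)).
have := ler_normD (E * (s - b)) ((E - 1 - a) * b + a * b).
have := ler_normD ((E - 1 - a) * b) (a * b).
have := sqr_ge0 a; have := sqr_ge0 b; lra.
Qed.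

Lemma differentiable_cexp (w : CC R) : differentiable (@cexp R : CC R -> CC R) w.
Proof.
apply/derivable1_diffP; apply/cvg_ex; exists (cexp w).
apply/(@cvgrPdist_lt _ (CC R)) => e e0.
have ee : e = (complex.Re e)%:C%C by rewrite RRe_real// gtr0_real.
have e0' : 0 < complex.Re e by rewrite -ltcR -ee.
apply/nbhs_cabsP; set c := cabs (cexp w).
have c0 : 0 < c by rewrite cabs_gt0 cexp_neq0.
(* The error of the difference quotient is [exp(w) h^-1 (exp h - 1 - h)]. The first radius makes the
   quadratic remainder estimate valid, the second makes [10 c |h| < e]. *)
exists (Num.min 2^-1 (complex.Re e / (10 * c))).
  by rewrite lt_min invr_gt0 ltr0n/= divr_gt0// mulr_gt0.
move=> h; rewrite sub0r cabsN lt_min => /andP[h1 h2] h0.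
rewrite ee cabsE ltcR.
have -> : (@cexp R \o shift w) h%:A = cexp w * cexp h.
  by rewrite /= /GRing.scale/= mulr1 addrC cexpD.
have -> : cexp w - h^-1 *: (cexp w * cexp h - cexp w) =
   - (cexp w * h^-1 * (cexp h - 1 - h)).
  have -> : h^-1 *: (cexp w * cexp h - cexp w) = h^-1 * (cexp w * cexp h - cexp w) by [].
  by field.
rewrite cabsN !cabsM cabsV.
have ch0 : 0 < cabs h by rewrite cabs_gt0.
rewrite ltr_pdivlMr ?mulr_gt0// in h2.
rewrite mulrAC ltr_pdivrMr// -/c.
have := cabs_cexp_sub_le (ltW h1).
move=> hh; apply: (@le_lt_trans _ _ (c * (10 * cabs h ^+ 2))).
  by rewrite ler_pM2l.
nra.
Qed.

End ExponentialDerivative.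

(** * Roots of polynomials in an annulus *)

Section RootsInAnnulus.
Variable R : realType.
Local Notation C := (CC R).
Implicit Types (a c y z : C) (s : seq C) (r : R) (F : {poly C}).

Lemma prodr_const_seq (S : pzSemiRingType) (T : Type) (t : seq T) (x : S) :
  \prod_(i <- t) x = x ^+ size t.
Proof. by rewrite big_const_seq count_predT iter_mulr_1 /=. Qed.

Lemma ler_prod_seq (T : eqType) (s : seq T) (f g : T -> R) :
  (forall z : T, z \in s -> 0 <= f z <= g z) ->
  \prod_(z <- s) f z <= \prod_(z <- s) g z.
Proof. by move=> fg; rewrite !big_seq; exact: ler_prod. Qed.

Lemma prod_lt_expr (T : eqType) (s : seq T) (f : T -> R) (B : R) :
  s != [::] -> (forall z : T, z \in s -> 0 <= f z < B) ->
  \prod_(z <- s) f z < B ^+ size s.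
Proof.
elim: s => // x s IHs _ fB.
have /andP[fx0 fxB] := fB x (mem_head _ _).
have [->|s0] := eqVneq s [::]; first by rewrite big_seq1 expr1.
rewrite big_cons exprS ltr_pM//.
  rewrite big_seq prodr_ge0// => z zs.
  by case/andP: (fB z (mem_behead (zs : z \in behead (x :: s)))).
by apply: IHs => // z zs; apply: fB; rewrite inE zs orbT.
Qed.

Lemma prod_gt_expr (T : eqType) (s : seq T) (f : T -> R) (B : R) :
  0 <= B -> s != [::] -> (forall z : T, z \in s -> B < f z) ->
  B ^+ size s < \prod_(z <- s) f z.
Proof.
move=> B0; elim: s => // x s IHs _ fB.
have fxB := fB x (mem_head _ _).
have [->|s0] := eqVneq s [::]; first by rewrite big_seq1 expr1.
rewrite big_cons exprS ltr_pM ?exprn_ge0//.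
by apply: IHs => // z zs; apply: fB; rewrite inE zs orbT.
Qed.

(** Evaluate [X^M - 1], split into its linear factors, at [a / r]. *)
Lemma roots_of_unity_prod M r : (0 < M)%N -> 0 < r ->
  exists s, [/\ size s = M, forall z, z \in s -> cabs z = 1 &
    forall a, \prod_(z <- s) cabs (r%:C%C * z - a) = cabs (r%:C%C ^+ M - a ^+ M)].
Proof.
move=> M0 r0.
have [s sE] := closed_field_poly_normal ('X^M - 1 : {poly C}).
rewrite lead_coefXnsubC// scale1r in sE.
have sM : size s = M.
  by apply: succn_inj; rewrite -(size_prod_XsubC s id) -sE size_XnsubC.
have rC : r%:C%C != 0 :> C by rewrite -cabs_eq0 cabs_real normr_eq0 gt_eqF.
exists s; split=> // [z zs|a].
  have : root ('X^M - 1 : {poly C}) z by rewrite sE root_prod_XsubC.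
  rewrite rootE !hornerE subr_eq0 => /eqP zM.
  apply/eqP; rewrite -(eqrXn2 M0) ?cabs_ge0//.
  by rewrite -cabsX zM cabs1 expr1n.
have e : cabs ((a / r%:C%C) ^+ M - 1) = \prod_(z <- s) cabs (a / r%:C%C - z).
  have -> : (a / r%:C%C) ^+ M - 1 = ('X^M - 1 : {poly C}).[a / r%:C%C].
    by rewrite hornerD hornerN hornerXn hornerC.
  rewrite sE horner_prod cabs_prod; apply: eq_bigr => z _.
  by rewrite hornerXsubC.
have -> : r%:C%C ^+ M - a ^+ M = - (r%:C%C ^+ M * ((a / r%:C%C) ^+ M - 1)).
  by rewrite expr_div_n mulrBr mulrCA divff ?expf_neq0// !mulr1 opprB.
rewrite cabsN cabsM e cabsX -sM -[in RHS]prodr_const_seq -big_split/=.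
apply: eq_bigr => z _; rewrite -cabsM mulrBr mulrCA divff// mulr1.
exact: cabs_distC.
Qed.

Lemma leq_of_ltr_expr r m n : 1 < r -> r ^+ m < r ^+ n.+1 -> (m <= n)%N.
Proof. by move=> r1; rewrite ltr_eXn2l. Qed.

(** By Jensen's formula, the geometric mean of [|F|] on the circle of radius [r], for [F] with
    leading coefficient [c] and roots [s]. *)
Definition mahler c s r : R := cabs c * \prod_(a <- s) Num.max r (cabs a).

Lemma mahler_ge0 c s r : 0 <= r -> 0 <= mahler c s r.
Proof.
by move=> r0; rewrite mulr_ge0 ?cabs_ge0 ?prodr_ge0// => a _; rewrite le_max r0.
Qed.

(* The product of the values of the polynomial at the [size s + 1] points    *)
(* [r * z], [z] a root of unity, factors as a product over its roots [a] of   *)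
(* the distances from [r ^+ M] to [a ^+ M]. *)
Lemma geometric_mean c s r : 0 < r ->
  (forall a, a \in s -> cabs a <= r / 2 \/ 2 * r <= cabs a) ->
  let F := c *: \prod_(a <- s) ('X - a%:P) in
  (exists2 y, cabs y = r & mahler c s r / 2 <= cabs F.[y]) /\
  (exists2 y, cabs y = r & cabs F.[y] <= 2 * mahler c s r).
Proof.
(* Comparing each root's factor with its maximum costs [2^(size s)] in all. With [M > size s] points
   this is at most [2^M], hence a factor 2 in the geometric mean. *)
move=> r0 gap F; set M := (size s).+1.
have [t [tM t1 tE]] := @roots_of_unity_prod M r isT r0.
have rt z : z \in t -> cabs (r%:C%C * z) = r.
  by move=> /t1 z1; rewrite cabsM z1 mulr1 cabs_real gtr0_norm.
have t0 : t != [::] by rewrite -size_eq0 tM.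
have FE : \prod_(z <- t) cabs F.[r%:C%C * z] =
    cabs c ^+ M * \prod_(a <- s) cabs (r%:C%C ^+ M - a ^+ M).
  rewrite -tM -prodr_const_seq.
  under [X in _ = _ * X]eq_bigr do rewrite tM -tE.
  rewrite exchange_big/= -big_split/=; apply: eq_bigr => z _.
  rewrite hornerZ cabsM horner_prod cabs_prod; congr (_ * _).
  by apply: eq_bigr => a _; rewrite !hornerE.
(* Since [|a|] and [r] differ by a factor at least 2, the smaller [M]-th power is at most half the
   larger one. *)
have bd a : a \in s -> Num.max r (cabs a) ^+ M / 2 <= cabs (r%:C%C ^+ M - a ^+ M)
    <= Num.max r (cabs a) ^+ M * 2.
  move=> /gap ra.
  have h2 : (2^-1 : R) ^+ M <= 2^-1.
    by rewrite exprS ler_piMr ?invr_ge0// exprn_ile1 ?invr_ge0// invf_le1// ler1n.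
  have rM : cabs (r%:C%C ^+ M) = r ^+ M by rewrite cabsX cabs_real gtr0_norm.
  have u1 := cabsB (r%:C%C ^+ M) (a ^+ M).
  have u2 := cabsB (a ^+ M) (r%:C%C ^+ M).
  have u3 := cabsD (r%:C%C ^+ M) (- a ^+ M).
  rewrite cabs_distC rM in u2; rewrite rM in u1; rewrite cabsN rM in u3.
  rewrite cabsX in u1 u2 u3.
  have ca := cabs_ge0 a.
  case: ra => ra.
    have -> : Num.max r (cabs a) = r by apply/max_l; lra.
    have aM : cabs a ^+ M <= r ^+ M / 2.
      apply: le_trans (_ : (r / 2) ^+ M <= _); first by rewrite lerXn2r// nnegrE//; lra.
      by rewrite expr_div_n -exprVn ler_wpM2l// exprn_ge0// ltW.
    have := exprn_ge0 M (ltW r0); lra.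
  have -> : Num.max r (cabs a) = cabs a by apply/max_r; lra.
  have aM : r ^+ M <= cabs a ^+ M / 2.
    apply: le_trans (_ : (cabs a / 2) ^+ M <= _); first by rewrite lerXn2r// ?nnegrE; lra.
    by rewrite expr_div_n -exprVn ler_wpM2l// exprn_ge0// ltW.
  have := exprn_ge0 M ca; lra.
have max0 a : 0 <= Num.max r (cabs a) by rewrite le_max ltW.
have mM : mahler c s r ^+ M = cabs c ^+ M * \prod_(a <- s) Num.max r (cabs a) ^+ M.
  by rewrite exprMn prodrXl.
have m0 := mahler_ge0 c s (ltW r0).
have cM0 : 0 <= cabs c ^+ M by rewrite exprn_ge0 ?cabs_ge0.
split; apply: contrapT => h.
  have lt_m z : z \in t -> 0 <= cabs F.[r%:C%C * z] < mahler c s r / 2.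
    move=> zt; rewrite cabs_ge0 ltNge; apply/negP => ?.
    by apply: h; exists (r%:C%C * z) => //; exact: rt.
  have := prod_lt_expr t0 lt_m; rewrite FE tM expr_div_n mM.
  apply/negP; rewrite -leNgt -mulrA ler_wpM2l//.
  apply: le_trans (_ : \prod_(a <- s) (Num.max r (cabs a) ^+ M / 2) <= _); last first.
    apply: ler_prod_seq => a /bd/andP[-> _]; rewrite andbT.
    by rewrite divr_ge0 ?exprn_ge0.
  rewrite big_split/= prodr_const_seq ler_wpM2l//.
    by rewrite prodr_ge0// => a _; rewrite exprn_ge0.
  by rewrite -exprVn exprS ler_piMl ?invr_ge0 ?exprn_ge0// invf_le1// ler1n.
have lt_m z : z \in t -> 2 * mahler c s r < cabs F.[r%:C%C * z].
  move=> zt; rewrite ltNge; apply/negP => ?.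
  by apply: h; exists (r%:C%C * z) => //; exact: rt.
have := prod_gt_expr (mulr_ge0 (ler0n R 2) m0) t0 lt_m; rewrite FE tM exprMn mM.
apply/negP; rewrite -leNgt mulrCA ler_wpM2l//.
apply: le_trans (_ : \prod_(a <- s) (Num.max r (cabs a) ^+ M * 2) <= _).
  by apply: ler_prod_seq => a /bd/andP[_ ->]; rewrite cabs_ge0.
rewrite big_split/= prodr_const_seq mulrC ler_wpM2r//.
  by rewrite prodr_ge0// => a _; rewrite exprn_ge0.
by rewrite exprS ler_peMl ?exprn_ge0// ler1n.
Qed.

(** A root of modulus below [r1] contributes the radius itself, one beyond [r2] a constant. *)
Lemma mahler_loglinear c s r1 r2 : 0 < r1 -> r1 <= r2 ->
  (forall a, a \in s -> cabs a < r1 \/ r2 < cabs a) ->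
  mahler c s r2 * r1 ^+ count (fun a => cabs a < r1) s =
  mahler c s r1 * r2 ^+ count (fun a => cabs a < r1) s.
Proof.
move=> r10 r12; elim: s => [|a s IHs] gap; first by rewrite /mahler !big_nil.
have {}IHs := IHs (fun b bs => gap b (mem_behead (bs : b \in behead (a :: s)))).
have mE r : mahler c (a :: s) r = Num.max r (cabs a) * mahler c s r.
  by rewrite /mahler big_cons mulrCA.
rewrite !mE /= !exprD mulrACA IHs [RHS]mulrACA; congr (_ * _).
have [ar|ar] := gap a (mem_head _ _).
  rewrite ar !expr1 !max_l ?ltW//; last exact: lt_le_trans ar r12.
  by rewrite mulrC.
have -> : (cabs a < r1) = false by apply/negbTE; rewrite -leNgt ltW// (le_lt_trans r12).
by rewrite !expr0 !max_r// ltW// (le_lt_trans r12).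
Qed.

(** Multiplying by [X - a] raises the weighted coefficient bound by at most
    [r + |a| <= 2 max(r, |a|)]. *)
Lemma coef_le_mahler c s r i : 0 < r ->
  cabs (c *: \prod_(a <- s) ('X - a%:P))`_i * r ^+ i <= 2 ^+ size s * mahler c s r.
Proof.
move=> r0; rewrite /mahler mulrCA coefZ cabsM -mulrA ler_wpM2l ?cabs_ge0//.
elim: s i => [|a s IHs] i.
  rewrite !big_nil coef1 mul1r; case: i => [|i]; first by rewrite cabs1 !mul1r.
  by rewrite cabs0 mul0r.
rewrite !big_cons exprS mulrACA mulrBl coefB coefXM coefCM.
set G := \prod_(j <- s) ('X - j%:P) in IHs *.
set B := 2 ^+ size s * _ in IHs *.
have B0 : 0 <= B.
  rewrite mulr_ge0 ?exprn_ge0// prodr_ge0// => b _.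
  by rewrite le_max (ltW r0).
have mr : r <= Num.max r (cabs a) by rewrite le_max lexx.
have ma : cabs a <= Num.max r (cabs a) by rewrite le_max lexx orbT.
have h1 : cabs (if i == 0%N then 0 else G`_i.-1) * r ^+ i <= r * B.
  case: i => [|i] /=; first by rewrite cabs0 mul0r mulr_ge0// ltW.
  by rewrite exprS mulrCA ler_pM2l.
have h2 : cabs (a * G`_i) * r ^+ i <= cabs a * B.
  by rewrite cabsM -mulrA ler_wpM2l ?cabs_ge0.
have := cabsD (if i == 0%N then 0 else G`_i.-1) (- (a * G`_i)); rewrite cabsN => h3.
apply: le_trans (_ : (r + cabs a) * B <= _); last by rewrite ler_wpM2r//; lra.
rewrite mulrDl; apply: le_trans (lerD h1 h2); rewrite -mulrDl ler_wpM2r//.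
by rewrite exprn_ge0// ltW.
Qed.

(* If the roots avoid the annulus, the Mahler measure is log-linear in the   *)
(* radius there, and the dominant term fixes both its slope and its value.   *)
Lemma root_in_annulus F a p i D r r2 : a != 0 -> 0 < r -> 64 * r <= r2 ->
  (size F <= D.+1)%N ->
  (forall y, cabs y = r \/ cabs y = 32 * r ->
     cabs (F.[y] - a * y ^+ p) <= cabs a * cabs y ^+ p / 2) ->
  2 ^+ D * 4 * cabs a * r2 ^+ p < cabs F`_i * r2 ^+ i ->
  exists y, [/\ root F y, r / 2 <= cabs y & cabs y <= r2].
Proof.
move=> a0 r0 rr2 FD dom big_coef; apply: contrapT => noroot.
have [s FE] := closed_field_poly_normal F; set c := lead_coef F in FE.
have F0 : F != 0.
  apply: contraTneq big_coef => ->; rewrite coef0 cabs0 mul0r -leNgt.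
  by rewrite !mulr_ge0 ?exprn_ge0 ?cabs_ge0//; lra.
have c0 : c != 0 by rewrite lead_coef_eq0.
have sD : (size s <= D)%N.
  by move: FD; rewrite FE size_scale// size_prod_XsubC.
have gap z : z \in s -> cabs z < r / 2 \/ r2 < cabs z.
  move=> zs; have [|h1] := ltP (cabs z) (r / 2); first by left.
  have [|h2] := ltP r2 (cabs z); first by right.
  case: noroot; exists z; split=> //.
  by rewrite FE rootZ// root_prod_XsubC.
(* Having no root in [[r/2, r2]], with [r2 >= 64 r], leaves the factor-2 gap that [geometric_mean]
   requires around both circles. On them [F] is close to [a y^p], which pins down the Mahler
   measure. *)
have pinch x : x = r \/ x = 32 * r ->
    cabs a * x ^+ p <= 4 * mahler c s x /\ mahler c s x <= 4 * (cabs a * x ^+ p).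
  move=> xr; have x0 : 0 < x by lra.
  have [|[y1 y1x h1] [y2 y2x h2]] := @geometric_mean c s x x0.
    by move=> z /gap; lra.
  rewrite -FE in h1 h2.
  have d1 : cabs y1 = r \/ cabs y1 = 32 * r by rewrite y1x.
  have d2 : cabs y2 = r \/ cabs y2 = 32 * r by rewrite y2x.
  have e1 := dom _ d1; have e2 := dom _ d2.
  rewrite y1x in e1; rewrite y2x in e2.
  have f1 := cabsD (F.[y1] - a * y1 ^+ p) (a * y1 ^+ p).
  have f2 := cabsB (a * y2 ^+ p) (a * y2 ^+ p - F.[y2]).
  rewrite subKr cabs_distC in f2; rewrite subrK in f1.
  move: f1 f2; rewrite ![cabs (a * _ ^+ p)]cabsM !cabsX y1x y2x => f1 f2.
  have m0 := mahler_ge0 c s (ltW x0).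
  have := mulr_ge0 (cabs_ge0 a) (exprn_ge0 p (ltW x0)).
  set A := cabs a * x ^+ p in e1 e2 f1 f2 *.
  lra.
have [l1 u1] := pinch r (or_introl erefl).
have [l2 u2] := pinch (32 * r) (or_intror erefl).
have ca : 0 < cabs a by rewrite cabs_gt0.
have rp := exprn_gt0 p r0.
pose n := count (fun z => cabs z < r) s.
have lin x : r <= x <= r2 -> mahler c s x * r ^+ n = mahler c s r * x ^+ n.
  move=> /andP[rx xr2]; apply: mahler_loglinear => // z /gap.
  by lra.
have m0 : 0 < mahler c s r.
  have : 0 < cabs a * r ^+ p by rewrite mulr_gt0.
  lra.
have mE : mahler c s (32 * r) = mahler c s r * 32 ^+ n.
  have := lin (32 * r); rewrite exprMn mulrA => e.
  by apply: (mulIf (lt0r_neq0 (exprn_gt0 n r0))); apply: e; lra.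
(* From [r] to [32 r] the Mahler measure grows by [32^n], which agrees with [32^p] up to a factor
   16; as 16 < 32, the exponents coincide. *)
have np : n = p.
  have X0 : 0 < cabs a * r ^+ p by rewrite mulr_gt0.
  move: l2 u2; rewrite mE exprMn [cabs a * _]mulrCA.
  set X := cabs a * r ^+ p in l1 u1 X0 *; set m := mahler c s r in l1 u1 m0 *.
  have h32 : 1 < 32 :> R by rewrite ltr1n.
  have := exprn_gt0 n (ltr0Sn R 31); have := exprn_gt0 p (ltr0Sn R 31).
  move=> u0 v0 l2 u2; apply/eqP; rewrite eqn_leq; apply/andP; split.
    apply: (leq_of_ltr_expr h32); rewrite exprS; move: l2 u2 u0 v0.
    set u := _ ^+ p; set v := _ ^+ n => l2 u2 u0 v0.
    rewrite -(ltr_pM2r X0); have : m * v * 4 >= X * v by nra.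
    have := mulr_gt0 u0 X0; nra.
  apply: (leq_of_ltr_expr h32); rewrite exprS; move: l2 u2 u0 v0.
  set u := _ ^+ p; set v := _ ^+ n => l2 u2 u0 v0.
  rewrite -(ltr_pM2r X0); have : m * v <= 4 * X * v by nra.
  have := mulr_gt0 v0 X0; nra.
have r20 : 0 < r2 by lra.
(* Log-linearity carries the bound from [r] out to [r2], where [coef_le_mahler] contradicts the
   large coefficient. *)
have mr2 : mahler c s r2 <= 4 * (cabs a * r2 ^+ p).
  have := lin r2; rewrite np => e.
  have {}e : mahler c s r2 * r ^+ p = mahler c s r * r2 ^+ p by apply: e; lra.
  rewrite -(ler_pM2r rp) e.
  have := exprn_gt0 p r20; nra.
move: big_coef; apply/negP; rewrite -leNgt FE.
apply: le_trans (coef_le_mahler _ _ _ r20) _.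
rewrite -!mulrA; apply: ler_pM => //.
- by rewrite mahler_ge0// ltW.
- by rewrite ler_weXn2l// ler1n.
Qed.

End RootsInAnnulus.

(** * The action of the semidirect product *)

Section Differentiability.
Variables (K : numFieldType) (V W : normedModType K).

Lemma differentiable_fst (p : V * W) : differentiable (@fst V W) p.
Proof.
have cf : continuous (fst : V * W -> V) by move=> q; exact: cvg_fst.
exact: linear_differentiable.
Qed.

Lemma differentiable_snd (p : V * W) : differentiable (@snd V W) p.
Proof.
have cf : continuous (snd : V * W -> W) by move=> q; exact: cvg_snd.
exact: linear_differentiable.
Qed.

Lemma differentiable_expn (f : V -> K) n (p : V) :
  differentiable f p -> differentiable (fun q => f q ^+ n) p.
Proof.
move=> df; case: n => [|n]; first exact: differentiable_cst.
rewrite (_ : (fun q => _) = f ^+ n.+1); first exact: differentiableX.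
by apply/funext => q; rewrite exprfctE.
Qed.

Lemma differentiable_exprz (f : V -> K) (n : int) (p : V) :
  differentiable f p -> f p != 0 -> differentiable (fun q => f q ^ n) p.
Proof.
case: n => n df f0; first exact: differentiable_expn.
apply: (@differentiableV _ _ (fun q => f q ^+ n.+1)); first exact: differentiable_expn.
by rewrite expf_neq0.
Qed.

Lemma differentiable_bigsum n (f : 'I_n -> V -> W) (p : V) :
  (forall i, differentiable (f i) p) ->
  differentiable (fun q => \sum_(i < n) f i q) p.
Proof.
move=> df; rewrite (_ : (fun q => _) = \sum_(i < n) f i).
  exact: differentiable_sum.
by apply/funext => q; rewrite fct_sumE.
Qed.

Lemma differentiable_mul (f g : V -> K) (p : V) :
  differentiable f p -> differentiable g p -> differentiable (fun q => f q * g q) p.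
Proof. exact: differentiableM. Qed.

Lemma differentiable_add (f g : V -> W) (p : V) :
  differentiable f p -> differentiable g p -> differentiable (fun q => f q + g q) p.
Proof. exact: differentiableD. Qed.

Lemma differentiable_sub (f g : V -> W) (p : V) :
  differentiable f p -> differentiable g p -> differentiable (fun q => f q - g q) p.
Proof. exact: differentiableB. Qed.

Lemma differentiable_opp (f : V -> W) (p : V) :
  differentiable f p -> differentiable (fun q => - f q) p.
Proof. exact: differentiableN. Qed.

Lemma differentiable_mull (c : K) (f : V -> K) (p : V) :
  differentiable f p -> differentiable (fun q => c * f q) p.
Proof. by move=> df; apply: differentiable_mul => //; exact: differentiable_cst. Qed.

End Differentiability.

Lemma exprzDn (F : fieldType) (c : F) (M N : nat) (n : int) :
  c != 0 -> M%:Z = N%:Z + n -> c ^+ N * c ^ n = c ^+ M.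
Proof. by move=> c0 e; rewrite !exprnP -expfzDr// -e. Qed.

Section GroupLaw.
Variables (R : realType) (k l : nat).
Hypothesis k_gt1 : (1 < k)%N.
Local Notation C := (CC R).
Local Notation ambient := (ambient R k l).
Implicit Types (x y : int * rat) (w lam : C) (Q : {poly C}) (M N : nat) (p : ambient).

Let k0 : (k%:R : C) != 0. Proof. by rewrite pnatr_eq0 -lt0n ltnW. Qed.
Let kR0 : (0 : R) < k%:R. Proof. by rewrite ltr0n ltnW. Qed.

(* The automorphism g is [z |-> lam z + a0] in the coordinate obtained from  *)
(* z by adding the divergent series [twist lam Q oo w].                      *)
Definition twist lam Q M w : C :=
  \sum_(i < M) lam ^- i.+1 * Q.[cexp (- (k%:R ^+ i * w))].

Definition base_move x w : C := k%:R ^ x.1 * w + ratr x.2 * tpi R.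

(** The affine map [z |-> lam^n z + n a0], conjugated by the series truncated at order [M] at the
    source and [N] at the target. As [lam = 1] or [a0 = 0] on the parameter space, this affine map
    is the [n]-th iterate of [z |-> lam z + a0]. *)
Definition act_at x M N p : ambient :=
  let lam := p.2.1.1 in let Q := Qpoly p.2.2 in
  ((lam ^ x.1 * p.1.1 + x.1%:~R * p.2.1.2 +
      (lam ^ x.1 * twist lam Q M p.1.2 - twist lam Q N (base_move x p.1.2)),
    base_move x p.1.2), p.2).

(* Truncation orders at which the tails of the two series cancel. *)
Definition levels x (MN : nat * nat) : Prop :=
  MN.1%:Z = MN.2%:Z + x.1 /\ x.2 * k%:R ^+ MN.2 \is a Num.int.

(** By [act_at_levels] the choice of orders is immaterial when [lam] is nonzero. The default
    [(0, 0)] is taken only for [x] outside [ZZk]. *)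
Definition act x p : ambient :=
  let MN := xget (0%N, 0%N) [set MN | levels x MN] in act_at x MN.1 MN.2 p.

Lemma cexp_periodic w (m : int) : cexp (w + m%:~R * tpi R) = cexp w.
Proof. by rewrite cexpD cexp_tpi_int mulr1. Qed.

(** As [k^N a] is an integer, [k^N] times the moved [w] is [k^M w] up to a multiple of [2 pi i]; and
    [lam^n lam^-(M+1) = lam^-(N+1)]. So the two added terms cancel. *)
Lemma act_at_succ x M N p : p.2.1.1 != 0 -> levels x (M, N) ->
  act_at x M.+1 N.+1 p = act_at x M N p.
Proof.
case: x => n a l0 [/= MN /intrP[m am]]; rewrite /act_at /twist/= !big_ord_recr/=.
congr ((_ + _, _), _); rewrite mulrDr opprD addrACA -[RHS]addr0; congr (_ + _).
set Q := Qpoly _; set lam := p.2.1.1.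
have -> : cexp (- (k%:R ^+ N * base_move (n, a) p.1.2)) = cexp (- (k%:R ^+ M * p.1.2)) :> C.
  rewrite -[RHS](cexp_periodic _ (- m)); congr cexp.
  rewrite /base_move/= mulrDr opprD; congr (- _ + _).
    by rewrite mulrA (exprzDn k0 MN).
  rewrite rmorphN/= mulNr; congr (- _); rewrite mulrA; congr (_ * _).
  have := congr1 (ratr : rat -> C) am; rewrite ratr_int rmorphM rmorphXn/= ratr_nat.
  by rewrite mulrC.
rewrite mulrA; apply/eqP; rewrite subr_eq0; apply/eqP; congr (_ * _).
have -> : n = M%:Z - N%:Z by rewrite MN addrC addKr.
rewrite expfzDr// -invr_expz -!exprnP.
rewrite -[lam ^+ M]mul1r !exprS !invfM.
by rewrite mul1r mulrCA mulrAC divff ?mul1r// expf_neq0.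
Qed.

Lemma levels_succ x M N : levels x (M, N) -> levels x (M.+1, N.+1).
Proof.
move=> [/= MN aN]; split=> /=; first by lia.
by rewrite exprSr mulrA rpredM// natr_int.
Qed.

Lemma act_at_levels x M N M' N' p : p.2.1.1 != 0 ->
  levels x (M, N) -> levels x (M', N') -> act_at x M N p = act_at x M' N' p.
Proof.
move=> l0; wlog NN : M N M' N' / (N <= N')%N => [h L L'|].
  have [NN|/ltnW NN] := leqP N N'; first exact: (h _ _ _ _ NN L L').
  exact/esym/(h _ _ _ _ NN L' L).
move=> L L'.
have {L'} e : M' = (M + (N' - N))%N.
  by case: L L' => /= + _ [/= + _]; lia.
have -> : N' = (N + (N' - N))%N by rewrite subnKC.
rewrite {}e; move: (N' - N)%N => j; elim: j M N L {NN} => [|j IHj] M N L.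
  by rewrite !addn0.
by rewrite -[LHS]act_at_succ// !addnS -!addSn; apply: IHj; exact: levels_succ.
Qed.

Lemma levels_exist x N0 : ZZk k x -> exists M N, [/\ levels x (M, N), (N0 <= M)%N & (N0 <= N)%N].
Proof.
move=> [m xm]; exists (absz ((m + N0 + absz x.1)%:Z + x.1)), (m + N0 + absz x.1)%N.
split; [split=> /=; first by lia| by lia| by lia].
by rewrite -addnA exprD mulrA rpredM// -natrX natr_int.
Qed.

Lemma actE x M N p : p.2.1.1 != 0 -> levels x (M, N) -> act x p = act_at x M N p.
Proof.
move=> l0 L; rewrite /act; case: xgetP => [[M' N'] _ L'|/(_ (M, N))//].
exact: act_at_levels.
Qed.

Lemma act_base x p : (act x p).1.2 = base_move x p.1.2.
Proof. by []. Qed.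

Lemma base_moveM x y w :
  base_move (ZZk_mul k x y) w = base_move x (base_move y w).
Proof.
rewrite /base_move /= expfzDr// rmorphD rmorphM/= fmorphXz/= ratr_nat.
by rewrite mulrDr !mulrA mulrDl addrA addrAC.
Qed.

Lemma lam_a0 (lam a0 : C) (n : int) : lam != 0 -> (lam - 1) * a0 = 0 ->
  lam ^ n * a0 = a0.
Proof.
move=> l0 /eqP; rewrite mulf_eq0 subr_eq0 => /orP[/eqP->|/eqP->].
  by rewrite exp1rz mul1r.
by rewrite mulr0.
Qed.

Lemma actM x y p : ZZk k x -> ZZk k y -> setA p.2.1 ->
  act (ZZk_mul k x y) p = act x (act y p).
Proof.
move=> zx zy [l0 la].
have [M0 [N0 [[/= MN0 yN] _ _]]] := levels_exist 0 zy.
(* [M] is the source order for [x] and will be the target order for [y], so that the series at the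
   intermediate point cancel. The lower bound makes [M] admissible for [y] and [M + y.1]
   nonnegative. *)
have [M [N [Lx M0M N0N]]] := levels_exist (N0 + absz y.1) zx.
have Ly : levels y (absz (M%:Z + y.1), M).
  split=> /=; first by lia.
  have -> : M = (N0 + (M - N0))%N by lia.
  by rewrite exprD mulrA rpredM// -natrX natr_int.
have Lxy : levels (ZZk_mul k x y) (absz (M%:Z + y.1), N).
  case: Lx Ly => /= MN xN [/= MM yM]; split=> /=; first by lia.
  rewrite mulrDl rpredD//.
  have kq : (k%:R : rat) != 0 by rewrite pnatr_eq0 -lt0n ltnW.
  by rewrite [_ * y.2]mulrC -mulrA [_ ^ _ * _]mulrC (exprzDn kq MN).
rewrite (actE l0 Lxy) (actE _ Lx)// (actE l0 Ly) /act_at/= base_moveM.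
congr ((_, _), _); rewrite expfzDr//.
rewrite !mulrDr intrD mulrDl [_ ^ x.1 * (y.1%:~R * _)]mulrCA (lam_a0 x.1 l0 la).
by ring.
Qed.

Lemma act1 p : p.2.1.1 != 0 -> act (ZZk_one) p = p.
Proof.
move=> l0; have L : levels ZZk_one (0, 0)%N by split=> //=; rewrite mul0r.
rewrite (actE l0 L) /act_at /twist !big_ord0 /base_move/= !expr0z !mul1r !mul0r !addr0.
by rewrite rmorph0 mul0r addr0 subr0 addr0; case: p {l0} => [[? ?] ?].
Qed.

Lemma Re_base_move x w : complex.Re (base_move x w) = k%:R ^ x.1 * complex.Re w.
Proof.
rewrite /base_move Re_addC.
have -> : (k%:R : C) ^ x.1 = (k%:R ^ x.1)%:C%C by rewrite (fmorphXz (real_complex R)) rmorph_nat.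
have -> : (ratr x.2 : C) = (ratr x.2)%:C%C by rewrite (fmorph_rat (real_complex R)).
by rewrite tpiM/= addr0; case: w => u v; simpc.
Qed.

Lemma Im_base_move x w :
  complex.Im (base_move x w) = k%:R ^ x.1 * complex.Im w + ratr x.2 * (2 * pi).
Proof.
rewrite /base_move.
have -> : (k%:R : C) ^ x.1 = (k%:R ^ x.1)%:C%C by rewrite (fmorphXz (real_complex R)) rmorph_nat.
have -> : (ratr x.2 : C) = (ratr x.2)%:C%C by rewrite (fmorph_rat (real_complex R)).
by rewrite tpiM/=; case: w => u v; simpc.
Qed.

Lemma act_fibered x p (T : set (param R k l)) :
  fibered_over T p -> fibered_over T (act x p).
Proof.
move=> [hp Tp]; split=> //; rewrite /half_plane/= Re_base_move.
by rewrite pmulr_rlt0// exprz_gt0.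
Qed.

(** The real part of [w] is nonzero and gets multiplied by [k^n], so [n = 0]; then the imaginary
    part moves by [2 pi a]. *)
Lemma act_free x p : half_plane p.1 -> act x p = p -> x = (0, 0).
Proof.
case: x => n a hp /(congr1 (fun q => q.1.2)); rewrite act_base => e.
have := congr1 (@complex.Re R) e; rewrite Re_base_move/= => /esym.
rewrite -[LHS]mul1r => /(mulIf (ltr0_neq0 hp)).
rewrite -(expr0z (k%:R : R)) => /(ieexprIz kR0) n0.
have {}n0 : n = 0 by apply/esym/n0; rewrite gt_eqF// ltr1n.
rewrite n0 in e *; congr pair.
move/(congr1 (@complex.Im R)): e; rewrite Im_base_move/= expr0z mul1r.
move=> e; have /eqP : (ratr a : R) * (2 * pi) = 0 by lra.
rewrite mulf_eq0 => /orP[|].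
  by rewrite fmorph_eq0 => /eqP.
by rewrite gt_eqF// mulr_gt0// pi_gt0.
Qed.

Lemma differentiable_twist M (f : ambient -> C) p : p.2.1.1 != 0 ->
  differentiable f p ->
  differentiable (fun q => twist q.2.1.1 (Qpoly q.2.2) M (f q)) p.
Proof.
move=> l0 df; apply: differentiable_bigsum => i.
have d2 := differentiable_snd p.
have dlam : differentiable (fun q : ambient => q.2.1.1) p.
  apply: (differentiable_comp (f := fun q : ambient => q.2.1) (g := fst)).
    apply: (differentiable_comp (g := fst)) => //; exact: differentiable_fst.
  exact: differentiable_fst.
apply: (differentiable_mul (f := fun q : ambient => q.2.1.1 ^- i.+1)
  (g := fun q : ambient => (Qpoly q.2.2).[cexp (- (k%:R ^+ i * f q))])).
  apply: (differentiableV (f := fun q : ambient => q.2.1.1 ^+ i.+1)).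
    exact: differentiable_expn.
  by rewrite expf_neq0.
rewrite (_ : (fun q => _) = fun q : ambient => \sum_(j < l * k - l)
    (q.2.2 0 j * cexp (- (k%:R ^+ i * f q)) ^+ (l + j))); last first.
  apply/funext => q; rewrite horner_sum; apply: eq_bigr => j _.
  by rewrite hornerZ hornerXn.
apply: differentiable_bigsum => j.
apply: (differentiable_mul (f := fun q : ambient => q.2.2 0 j)
  (g := fun q : ambient => cexp (- (k%:R ^+ i * f q)) ^+ (l + j))).
  apply: (differentiable_comp (f := fun q : ambient => q.2.2) (g := fun b => b 0 j)).
    apply: (differentiable_comp (g := snd)) => //; exact: differentiable_snd.
  exact: differentiable_coord.
apply: (differentiable_expn (f := fun q : ambient => cexp (- (k%:R ^+ i * f q)))).
apply: (differentiable_comp (f := fun q : ambient => - (k%:R ^+ i * f q)) (g := @cexp R)).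
  apply: (differentiable_opp (f := fun q : ambient => k%:R ^+ i * f q)).
  exact: (differentiable_mull (k%:R ^+ i) (f := f)).
exact: differentiable_cexp.
Qed.

Lemma differentiable_act_at x M N p : p.2.1.1 != 0 -> differentiable (act_at x M N) p.
Proof.
move=> l0.
have d2 := differentiable_snd p; have d1 := differentiable_fst p.
have da : differentiable (fun q : ambient => q.2.1) p.
  by apply: (differentiable_comp (g := fst)) => //; exact: differentiable_fst.
have dlam : differentiable (fun q : ambient => q.2.1.1 ^ x.1) p.
  apply: (differentiable_exprz (f := fun q : ambient => q.2.1.1)) => //.
  apply: (differentiable_comp (f := fun q : ambient => q.2.1) (g := fst)) => //.
  exact: differentiable_fst.
have da0 : differentiable (fun q : ambient => q.2.1.2) p.
  apply: (differentiable_comp (f := fun q : ambient => q.2.1) (g := snd)) => //.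
  exact: differentiable_snd.
have dz : differentiable (fun q : ambient => q.1.1) p.
  by apply: (differentiable_comp (g := fst)) => //; exact: differentiable_fst.
have dw : differentiable (fun q : ambient => q.1.2) p.
  by apply: (differentiable_comp (g := snd)) => //; exact: differentiable_snd.
have dm : differentiable (fun q : ambient => base_move x q.1.2) p.
  apply: (differentiable_add (f := fun q : ambient => k%:R ^ x.1 * q.1.2)
    (g := fun=> ratr x.2 * tpi R)); last exact: differentiable_cst.
  exact: (differentiable_mull (k%:R ^ x.1) (f := fun q : ambient => q.1.2)).
have dt1 := differentiable_twist M l0 dw; have dt2 := differentiable_twist N l0 dm.
have e1 := differentiable_mul dlam dz.
have e2 := differentiable_mull x.1%:~R da0.
have e3 := differentiable_sub (differentiable_mul dlam dt1) dt2.
have e4 := differentiable_add (differentiable_add e1 e2) e3.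
exact: (differentiable_pair (differentiable_pair e4 dm) d2).
Qed.

Lemma near_lam_neq0 p : p.2.1.1 != 0 -> \forall q \near p, q.2.1.1 != 0.
Proof.
move=> l0.
have cl : {for p, continuous (fun q : ambient => cabs q.2.1.1)}.
  apply: (@continuous_comp _ _ _ (fun q : ambient => q.2.1.1) (@cabs R)).
    apply: differentiable_continuous.
    apply: (differentiable_comp (f := fun q : ambient => q.2.1) (g := fst)).
      apply: (differentiable_comp (g := fst)); first exact: differentiable_snd.
      exact: differentiable_fst.
    exact: differentiable_fst.
  exact: continuous_cabs.
have cp : 0 < cabs p.2.1.1 by rewrite cabs_gt0.
have h : nbhs p [set q : ambient | 0 < cabs q.2.1.1] by exact: cl (lt_nbhsr cp).
by apply: filterS h => q /=; rewrite cabs_gt0.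
Qed.

Lemma act_holo_at x p : ZZk k x -> p.2.1.1 != 0 ->
  exists2 F : ambient -> ambient, holo_at F p & \forall q \near p, act x q = F q.
Proof.
move=> zx l0; have [M [N [L _ _]]] := levels_exist 0 zx.
exists (act_at x M N).
  by apply: filterS (near_lam_neq0 l0) => q; exact: differentiable_act_at.
by apply: filterS (near_lam_neq0 l0) => q ql; exact: actE.
Qed.

Lemma act_continuous x p : ZZk k x -> p.2.1.1 != 0 -> {for p, continuous (act x)}.
Proof.
move=> zx l0; have [F /nbhs_singleton dF eF] := act_holo_at zx l0.
have Fc := differentiable_continuous dF.
have eFp : act x p = F p by exact: nbhs_singleton eF.
move=> A; rewrite eFp => /Fc; apply: filterS2 eF => q eq.
by rewrite /= eq.
Qed.

Lemma act_g_gamma p : p.2.1.1 != 0 -> act (0, 1) p = g_gamma p.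
Proof.
move=> l0; have L : levels (0, 1) (0, 0)%N by split=> //=; rewrite mul1r rpred1.
rewrite (actE l0 L).
rewrite /act_at /twist !big_ord0 /g_gamma /base_move/= !expr0z !mul1r !mul0r addr0.
by rewrite subr0 addr0 rmorph1 mul1r.
Qed.

Lemma act_g_auto p : p.2.1.1 != 0 -> act (1, 0) p = g_auto p.
Proof.
move=> l0; have L : levels (1, 0) (1, 0)%N by split=> //=; rewrite mul0r.
rewrite (actE l0 L).
rewrite /act_at /twist big_ord0 big_ord_recr big_ord0 /g_auto /base_move/= !expr1z.
by rewrite !mul1r add0r rmorph0 mul0r !addr0 expr1 mulVKf// subr0.
Qed.

End GroupLaw.

(** * Quotients by properly discontinuous actions *)

Section Sequences.

Lemma eventually_forall (T : eqType) (P : T -> nat -> Prop) (s : seq T) :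
  (forall x, x \in s -> exists J, forall j, (J <= j)%N -> P x j) ->
  exists J, forall j, (J <= j)%N -> forall x, x \in s -> P x j.
Proof.
elim: s => [|x s IHs] ev; first by exists 0%N.
have [y ys|J1 J1P] := IHs; first by apply: ev; rewrite inE ys orbT.
have [J2 J2P] := ev x (mem_head _ _).
exists (maxn J1 J2) => j; rewrite geq_max => /andP[j1 j2] y.
by rewrite inE => /orP[/eqP->|]; [exact: J2P | exact: J1P].
Qed.

Definition seq_cvg (T : topologicalType) (u : nat -> T) (p : T) :=
  forall A, nbhs p A -> exists J, forall j, (J <= j)%N -> A (u j).

(** A filter on this set that does not cluster at [p] avoids a neighbourhood of [p], hence lives on
    finitely many terms. *)
Lemma compact_seq_cvg (T : topologicalType) (u : nat -> T) (p : T) :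
  seq_cvg u p -> compact (range u `|` [set p]).
Proof.
move=> up F FF FA; have [cp|ncp] := pselect (cluster F p).
  by exists p; split=> //; right.
have [B [U [FB Up BU]]] : exists B U, [/\ F B, nbhs p U & B `&` U = set0].
  apply: contrapT => h; apply: ncp => B U FB Up.
  by apply/set0P/negP => /eqP BU; apply: h; exists B, U.
have [J JP] := up U Up.
have cf : compact [set u j | j in `I_J] by apply: finite_compact; exact: finite_image.
have [|q [[j _ <-] cq]] := cf F FF; last by exists (u j); split=> //; left; exists j.
apply: filterS (filterI FA FB) => q [[[j _ <-]|->] Bq].
  exists j => //=; rewrite ltnNge; apply/negP => /JP Uj.
  by have : (B `&` U) (u j) by []; rewrite BU.
exfalso; have : (B `&` U) p by split=> //; exact: nbhs_singleton.
by rewrite BU.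
Qed.

Variables (R : realType) (E : normedModType (CC R)).

Definition small_ball (p : E) (j : nat) : set E := ball p (j.+1%:R^-1 : CC R).

Lemma nbhs_small_ball p j : nbhs p (small_ball p j).
Proof. by apply: nbhsx_ballx; rewrite invr_gt0 ltr0n. Qed.

Lemma small_ball_cvg (u : nat -> E) (p : E) :
  (forall j, small_ball p j (u j)) -> seq_cvg u p.
Proof.
move=> up A /nbhs_ballP[e /= e0 eA].
have ee : e = (complex.Re e)%:C%C by rewrite RRe_real// gtr0_real.
have e0' : 0 < complex.Re e by rewrite -ltcR -ee.
exists (Num.truncn (complex.Re e)^-1) => j Jj; apply/eA.
apply: le_ball (up j); rewrite ee.
have -> : (j.+1%:R^-1 : CC R) = (j.+1%:R^-1 : R)%:C%C by rewrite fmorphV rmorph_nat.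
rewrite lecR -[leRHS]invrK lef_pV2 ?posrE ?invr_gt0//.
apply: le_trans (ltW (truncnS_gt _)) _.
by rewrite ler_nat ltnS.
Qed.

End Sequences.

Section Quotient.
Variables (R : realType) (E : normedModType (CC R)) (G : choiceType).
Variables (Gam : set G) (act : G -> E -> E) (S : set E).
Hypothesis act_in : forall x p, Gam x -> S p -> S (act x p).
Hypothesis act_cont : forall x p, Gam x -> S p -> {for p, continuous (act x)}.
Hypothesis pd : prop_discontinuous Gam act S.

(** Both sequences with their limits form a compact set, so only finitely many group elements occur
    among the [x j]. One that does not map [p] to [q] can occur only finitely often, by continuity
    and separation. *)
Lemma limit_return (p q : E) (u v : nat -> E) (x : nat -> G) : S p -> S q ->
  (forall j, [/\ S (u j), S (v j), Gam (x j) & act (x j) (u j) = v j]) ->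
  seq_cvg u p -> seq_cvg v q ->
  exists2 j, act (x j) p = q & Gam (x j).
Proof.
move=> Sp Sq uv up vq.
set K := (range u `|` [set p]) `|` (range v `|` [set q]).
have KS : K `<=` S.
  move=> r [[[j _ <-]|->]|[[j _ <-]|->]] //; first by have [] := uv j.
  by have [] := uv j.
have cK : compact K by apply: compactU; exact: compact_seq_cvg.
have /finite_seqP[s sE] := pd KS cK.
apply: contrapT => h.
have [y ys|J /(_ J (leqnn J)) JP] := @eventually_forall G (fun y j => x j <> y) s.
  have [[j xj]|nxj] := pselect (exists j, x j = y); last first.
    by exists 0%N => j _ e; apply: nxj; exists j.
  have Gy : Gam y by rewrite -xj; have [] := uv j.
  have ypq : act y p <> q by move=> e; apply: h; exists j; rewrite xj.
  have : ~ cluster (nbhs (act y p)) q.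
    by move=> /(@norm_hausdorff _ E).
  move=> ncl.
  have [A [B [Ap Bq AB]]] : exists A B, [/\ nbhs (act y p) A, nbhs q B & A `&` B = set0].
    apply: contrapT => nAB; apply: ncl => A B nA nB.
    by apply/set0P/negP => /eqP e; apply: nAB; exists A, B.
  have [J1 J1P] := up _ (act_cont Gy Sp Ap).
  have [J2 J2P] := vq _ Bq.
  exists (maxn J1 J2) => i; rewrite geq_max => /andP[/J1P i1 /J2P i2] xi.
  have : (A `&` B) (v i) by split=> //; have [_ _ _ <-] := uv i; rewrite xi.
  by rewrite AB.
apply: (JP (x J)) => //.
have : [set y | Gam y /\ (act y @` K) `&` K !=set0] (x J).
  have [_ _ GJ uvJ] := uv J; split=> //; exists (v J); split.
    by exists (u J) => //; left; left; exists J.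
  by right; left; exists J.
by rewrite sE.
Qed.

Hypothesis act_free : forall x p, Gam x -> S p -> act x p = p ->
  forall q, S q -> act x q = q.

(** Otherwise there are pairs of distinct points in a common orbit, both tending to [p]. By
    [limit_return] one of the elements relating them fixes [p], hence acts trivially. *)
Lemma slice (p : E) : S p -> exists2 U, nbhs p U &
  forall x q r, Gam x -> S q -> S r -> U q -> U r -> act x q = r -> q = r.
Proof.
move=> Sp; apply: contrapT => h.
have bad j : {w : G * E * E | [/\ Gam w.1.1, S w.1.2, S w.2,
    small_ball p j w.1.2 /\ small_ball p j w.2 & act w.1.1 w.1.2 = w.2 /\ w.1.2 <> w.2]}.
  apply: cid; apply: contrapT => nw; apply: h.
  exists (small_ball p j); first exact: nbhs_small_ball.
  move=> x q r Gx Sq Sr Uq Ur xq; apply: contrapT => qr.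
  by apply: nw; exists (x, q, r).
pose w j := sval (bad j).
have wP j := svalP (bad j).
have [|||j xp Gx] := @limit_return p p (fun j => (w j).1.2) (fun j => (w j).2)
    (fun j => (w j).1.1) Sp Sp.
- by move=> j; have [? ? ? _ [? _]] := wP j.
- by apply: small_ball_cvg => j; have [_ _ _ [? _] _] := wP j.
- by apply: small_ball_cvg => j; have [_ _ _ [_ ?] _] := wP j.
have [_ Sq _ _ [e ne]] := wP j.
by apply: ne; rewrite -e [RHS](act_free Gx Sp xp).
Qed.

Variables (X : topologicalType) (pr : E -> X).
Hypothesis orb : is_orbit_space Gam act S pr.

Lemma orbit_map_open (W : set E) : open W -> open (pr @` (S `&` W)).
Proof.
have [_ fib top] := orb; move=> oW; apply/top.
exists (interior [set q | S q -> exists2 x, Gam x & W (act x q)]).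
  exact: open_interior.
apply/seteqP; split=> [q [Sq [r [Sr Wr] rq]]|q [Sq /interior_subset /(_ Sq)[x Gx Wq]]].
  split=> //; have [x Gx xq] : exists2 x, Gam x & act x q = r by apply/fib.
  have nW : nbhs (act x q) W by rewrite xq; exact: open_nbhs_nbhs.
  have n : nbhs q [set q' | W (act x q')] := act_cont Gx Sq nW.
  by apply: filterS n => q' Wq' _; exists x.
split=> //; exists (act x q); first by split=> //; exact: act_in.
apply/esym/fib => //; first exact: act_in.
by exists x.
Qed.

(** Since the orbit map is open, two inseparable orbits yield points tending to [p] and [q] and
    lying pairwise in a common orbit; [limit_return] then puts [q] in the orbit of [p]. *)
Lemma orbit_space_hausdorff : hausdorff_space X.
Proof.
have [sur fib top] := orb; move=> a b cab.
have [p Sp pa] : (pr @` S) a by rewrite sur.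
have [q Sq qb] : (pr @` S) b by rewrite sur.
have meet j : {w : G * E * E | [/\ Gam w.1.1, S w.1.2, S w.2,
    small_ball p j w.1.2 /\ small_ball q j w.2 & act w.1.1 w.1.2 = w.2]}.
  apply: cid.
  have nb c r : S r -> pr r = c ->
      nbhs c (pr @` (S `&` interior (small_ball r j))).
    move=> Sr <-; apply: open_nbhs_nbhs; split.
      exact/orbit_map_open/open_interior.
    by exists r => //; split=> //; exact: nbhs_small_ball.
  have [c [[p' [Sp' Bp'] p'c] [q' [Sq' Bq'] q'c]]] := cab _ _ (nb a p Sp pa) (nb b q Sq qb).
  have [x Gx xp'] : exists2 x, Gam x & act x p' = q' by apply/fib => //; rewrite p'c.
  by exists (x, p', q'); split=> //; split; exact: interior_subset.
pose w j := sval (meet j).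
have wP j := svalP (meet j).
have [|||j xp Gx] := @limit_return p q (fun j => (w j).1.2) (fun j => (w j).2)
    (fun j => (w j).1.1) Sp Sq.
- by move=> j; have [? ? ? _ ?] := wP j.
- by apply: small_ball_cvg => j; have [_ _ _ [? _] _] := wP j.
- by apply: small_ball_cvg => j; have [_ _ _ [_ ?] _] := wP j.
by rewrite -pa -qb; apply/fib => //; exists ((w j).1.1).
Qed.

Lemma orbit_map_continuous (A : set E) : A `<=` S -> {within A, continuous pr}.
Proof.
have [_ _ top] := orb; move=> AS; apply/continuousP => U oU.
have [V oV VE] := (top U).1 oU.
apply/open_subspaceP; exists V => //.
apply/seteqP; split=> q [h Aq]; split=> //.
  have : (S `&` V) q by split=> //; exact: AS.
  by rewrite -VE => -[].
have : (S `&` pr @^-1` U) q by split=> //; exact: AS.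
by rewrite VE => -[].
Qed.

End Quotient.

Section SmoothQuotient.
Variables (R : realType) (F P : normedModType (CC R)) (G : choiceType).
Variables (Gam : set G) (act : G -> F * P -> F * P) (H : set F) (T : cspace P).
Let Y : cspace (F * P)%type := prod_space H T.
Hypothesis H_open : open H.
Hypothesis act_in : forall x p, Gam x -> pts Y p -> pts Y (act x p).
Hypothesis act_cont : forall x p, Gam x -> pts Y p -> {for p, continuous (act x)}.
Hypothesis pd : prop_discontinuous Gam act (pts Y).
Hypothesis act_free : forall x p, Gam x -> pts Y p -> act x p = p ->
  forall q, pts Y q -> act x q = q.
Variables (X : topologicalType) (pr : F * P -> X).
Hypothesis orb : is_orbit_space Gam act (pts Y) pr.

Lemma germ_ideal0 (V : normedModType (CC R)) (I : set (V -> CC R)) (p : V) :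
  germ_ideal I p (fun=> 0).
Proof.
exists 0%N, (fun _ _ => 0), (fun _ _ => 0); split=> [[]//|].
by apply: nearW => q; rewrite big_ord0.
Qed.

(** The orbit map is injective on a slice, so a product neighbourhood inside a slice, with [psi] the
    identity, is a chart; on stalks there is then nothing to compare. *)
Lemma orbit_space_fibers_smoothly : fibers_smoothly T Y pr.
Proof.
move=> a; have [sur fib _] := orb.
have [p Yp pa] : (pr @` pts Y) a by rewrite sur.
have [U [[A B] /= [nA nB] ABU] sl] := slice act_cont pd act_free Yp.
exists (interior A `&` H), (interior B), id => /=.
split.
- by split; [apply: openI => //; exact: open_interior | exact: open_interior].
- move=> q [[_ Hq] [Tq _]]; split=> //.
    exact: (@filterE _ _ (nbhs_filter q)).
  split.
  + by apply: (@filterE _ _ (nbhs_filter q)) => r; have [] := is_diff_id r.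
  + by [].
  + move=> f hf; exists f => //.
    rewrite (_ : (fun q => _) = fun=> 0); first exact: germ_ideal0.
    by apply/funext => r; rewrite subrr.
- by exists p => //; split; [split=> //; exact: Yp.1 | split=> //; exact: Yp.2].
- split.
    move=> q r; rewrite !inE => -[[/interior_subset Aq Hq] [Tq /interior_subset Bq]].
    move=> [[/interior_subset Ar Hr] [Tr /interior_subset Br]] /= e.
    have /fib[||x Gx xq] := e => //.
    by apply: (sl x) => //; apply: ABU.
  by apply: (orbit_map_continuous orb) => q [[_ Hq] [Tq _]].
- move=> W oW.
  have -> : (pr \o id) @` (pts (prod_space (interior A `&` H) (open_part T (interior B))) `&` W)
     = pr @` (pts Y `&` ((interior A `&` H) `*` interior B `&` W)).
    congr (pr @` _); apply/seteqP; split=> q.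
      by move=> [[[? ?] [? ?]] ?].
    by move=> [[? ?] [[[? ?] ?] ?]].
  apply: (orbit_map_open act_in act_cont orb); apply: openI => //.
  have oAH : open (interior A `&` H) by apply: openI => //; exact: open_interior.
  rewrite openE => q [AHq Bq]; exists (interior A `&` H, interior B) => //=.
  by split; apply: open_nbhs_nbhs; split=> //; exact: open_interior.
Qed.

End SmoothQuotient.

(** * The type *)

Section TypeCombinatorics.
Variables (R : realType) (k l : nat).
Local Notation C := (CC R).
Implicit Types (Q : {poly C}) (d j m n : nat) (b : 'rV[C]_(l * k - l)).

(* [n] is the largest exponent of [Q] that [d] does not divide. These        *)
(* numbers, for [d] dividing [k], carry the same information as the type.    *)
Definition top_nmult d Q n : Prop :=
  [/\ Q`_n != 0, ~~ (d %| n)%N &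
      forall m, Q`_m != 0 -> ~~ (d %| m)%N -> (m <= n)%N].

Lemma top_nmult_uniq d Q n n' : top_nmult d Q n -> top_nmult d Q n' -> n = n'.
Proof.
by move=> [Qn dn max] [Qn' dn' max']; apply/eqP; rewrite eqn_leq max'// max.
Qed.

Lemma top_nmult_exists d Q : (exists2 m, Q`_m != 0 & ~~ (d %| m)%N) ->
  exists n, top_nmult d Q n.
Proof.
move=> ex; pose P m := (Q`_m != 0) && ~~ (d %| m)%N.
have exP : exists m, P m by case: ex => m Qm dm; exists m; apply/andP.
have bd m : P m -> (m <= size Q)%N.
  by move=> /andP[Qm _]; rewrite leqNgt; apply: contra Qm => /ltnW /leq_sizeP ->.
have [n /andP[Qn dn] max] := ex_maxnP exP bd.
by exists n; split=> // m Qm dm; apply: max; apply/andP.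
Qed.

Lemma Qpoly_coef b m : (Qpoly b)`_m =
  \sum_(i < l * k - l) (if (m == l + i)%N then b 0 i else 0).
Proof.
rewrite coef_sum; apply: eq_bigr => i _; rewrite coefZ coefXn.
by case: eqP; rewrite ?mulr1 ?mulr0.
Qed.

Lemma Qpoly_range b m : (Qpoly b)`_m != 0 -> (l <= m < l * k)%N.
Proof.
apply: contraR; rewrite Qpoly_coef => h; rewrite big1// => i _.
by case: eqP => // e; move: h; rewrite e; have := ltn_ord i; lia.
Qed.

Lemma size_Qpoly b : (size (Qpoly b) <= l * k)%N.
Proof.
apply/leq_sizeP => m lm; apply: contraTeq lm => /Qpoly_range.
by rewrite -ltnNge => /andP[].
Qed.

(** If [d] divided all exponents of [Q], it would divide their gcd with [k], which is 1. *)
Lemma setB_top_nmult b d : @setB R k l b -> (d %| k)%N -> (1 < d)%N ->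
  exists n, top_nmult d (Qpoly b) n.
Proof.
move=> [_ gcd1] dk d1; apply: top_nmult_exists; apply: contrapT => h.
suff : (d %| 1)%N by rewrite dvdn1; case: d d1 {dk h} => [|[]].
rewrite -gcd1; apply: (big_ind (fun n => d %| n)%N) => //.
  by move=> x y dx dy; rewrite dvdn_gcd dx.
by move=> i Qi; apply: contrapT => /negP di; apply: h; exists (i : nat).
Qed.

(** The degree lies strictly between [(l - 1) k] and [l k]. So the first entry of the type is the
    top exponent for [d = k]. *)
Lemma setB_degree b : @setB R k l b -> top_nmult k (Qpoly b) (size (Qpoly b)).-1.
Proof.
move=> [[m /andP[m1 m2] Qm] _].
have Q0 : Qpoly b != 0 by apply: contraNneq Qm => ->; rewrite coef0.
have Qd : (Qpoly b)`_(size (Qpoly b)).-1 != 0 by rewrite -lead_coefE lead_coef_eq0.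
have max j : (Qpoly b)`_j != 0 -> (j <= (size (Qpoly b)).-1)%N.
  move=> Qj; rewrite -ltnS prednK ?size_poly_gt0// ltnNge.
  by apply: contra Qj => /leq_sizeP ->.
split=> //; last by move=> j /max.
have := max _ Qm; have /andP[_] := Qpoly_range Qd.
set n := (_).-1 => n2 mn; apply/negP => /dvdnP[c cE].
have : (l.-1 * k < c * k < l * k)%N.
  by rewrite -cE n2 andbT -subn1 mulnBl mul1n; exact: leq_trans mn.
by rewrite !ltn_mul2r => /andP[/andP[_ +] /andP[_ +]]; lia.
Qed.

(** The invariant of [type_tail]: under it the restriction [i < n] in the recursion loses no
    exponent that [j] fails to divide, so the next entry is the top exponent for [j]. *)
Definition mult_above Q j n := forall m, Q`_m != 0 -> (n <= m)%N -> (j %| m)%N.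

Lemma type_tail_head Q j n n0 : (0 < j)%N -> mult_above Q j n -> top_nmult j Q n0 ->
  (\max_(i < n | (Q`_i != 0)%R && (gcdn j i < j)) i)%N = n0.
Proof.
move=> j0 inv [Qn jn max].
have n0n : (n0 < n)%N by rewrite ltnNge; apply: contra jn; exact: inv.
have gE i : (gcdn j i < j)%N = ~~ (j %| i)%N.
  rewrite ltn_neqAle dvdn_leq ?dvdn_gcdl// andbT; congr (~~ _).
  by apply/eqP/gcdn_idPl.
apply/eqP; rewrite eqn_leq; apply/andP; split.
  by apply/bigmax_leqP => i /andP[Qi]; rewrite gE => /(max _ Qi).
have := @leq_bigmax_cond _ (fun i : 'I_n => (Q`_i != 0) && (gcdn j i < j)%N)
  (fun i : 'I_n => i : nat) (Ordinal n0n).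
by apply; rewrite /= Qn gE.
Qed.

Lemma mult_above_step Q j n n0 : mult_above Q j n -> top_nmult j Q n0 ->
  mult_above Q (gcdn j n0) n0.
Proof.
move=> inv [Qn jn max] m Qm; rewrite leq_eqVlt => /orP[/eqP<-|nm].
  exact: dvdn_gcdr.
apply: dvdn_trans (dvdn_gcdl _ _) _; apply: contrapT => /negP jm.
by have := max _ Qm jm; rewrite leqNgt nm.
Qed.

Definition has_tops Q := forall d, (d %| k)%N -> (1 < d)%N -> exists n, top_nmult d Q n.

Lemma gcdn_lt j n : (0 < j)%N -> ~~ (j %| n)%N -> (gcdn j n < j)%N.
Proof.
move=> j0 jn; rewrite ltn_neqAle dvdn_leq ?dvdn_gcdl// andbT.
by apply: contra jn => /eqP <-; exact: dvdn_gcdr.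
Qed.

(** Let [n1] be the next entry. If [d] does not divide [n1], then [n1] is also the top exponent for
    [d], because non-multiples of [d] are non-multiples of [j]. Otherwise [d] divides
    [gcd(j, n1) < j] and the recursion goes on. *)
Lemma type_tail_top_nmult fuel Q1 Q2 j n d a : (0 < j <= fuel.+1)%N -> (j %| k)%N ->
  has_tops Q1 -> has_tops Q2 -> mult_above Q1 j n -> mult_above Q2 j n ->
  type_tail fuel Q1 j n = type_tail fuel Q2 j n ->
  (d %| j)%N -> (1 < d)%N -> top_nmult d Q1 a -> top_nmult d Q2 a.
Proof.
elim: fuel j n => [|fuel IHf] j n /andP[j0 jf] jk T1 T2 i1 i2 /=.
  have -> : j = 1%N by lia.
  by rewrite dvdn1 => _ /eqP->.
case: eqP => [->|/eqP j1]; first by rewrite dvdn1 => _ /eqP->.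
have j2 : (1 < j)%N by case: j j0 j1 {jf jk i1 i2} => [|[]].
have [n1 t1] := T1 j jk j2; have [n2 t2] := T2 j jk j2.
rewrite (type_tail_head j0 i1 t1) (type_tail_head j0 i2 t2) => -[e12].
rewrite -{n2}e12 in t2 * => et dj d1.
have [dn|dn] := boolP (d %| n1)%N.
  apply: (IHf (gcdn j n1) n1) => //.
  - rewrite gcdn_gt0 j0/= -ltnS; apply: leq_trans jf.
    by apply: gcdn_lt => //; case: t1.
  - exact: dvdn_trans (dvdn_gcdl _ _) jk.
  - exact: mult_above_step i1 t1.
  - exact: mult_above_step i2 t2.
  - by rewrite dvdn_gcd dj.
have up Q : top_nmult j Q n1 -> top_nmult d Q n1.
  move=> [Qn _ max]; split=> // m Qm dm; apply: max => //.
  by apply: contra dm; exact: dvdn_trans.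
by move=> /(top_nmult_uniq (up _ t1)) <-; exact: up.
Qed.

Lemma type_tail_eq fuel Q1 Q2 j n : (0 < j)%N -> (j %| k)%N ->
  has_tops Q1 -> mult_above Q1 j n -> mult_above Q2 j n ->
  (forall d a, (d %| k)%N -> (1 < d)%N -> top_nmult d Q1 a -> top_nmult d Q2 a) ->
  type_tail fuel Q1 j n = type_tail fuel Q2 j n.
Proof.
elim: fuel j n => [//|fuel IHf] j n j0 jk T1 i1 i2 h /=.
case: eqP => [//|/eqP j1].
have j2 : (1 < j)%N by case: j j0 j1 {jk i1 i2} => [|[]].
have [n1 t1] := T1 j jk j2; have t2 := h _ _ jk j2 t1.
rewrite (type_tail_head j0 i1 t1) (type_tail_head j0 i2 t2); congr cons.
apply: IHf => //.
- by rewrite gcdn_gt0 j0.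
- exact: dvdn_trans (dvdn_gcdl _ _) jk.
- exact: mult_above_step i1 t1.
- exact: mult_above_step i2 t2.
Qed.

Lemma mult_above_degree Q n : (0 < k)%N -> top_nmult k Q n -> (n = (size Q).-1) ->
  mult_above Q (gcdn k n) n.
Proof.
move=> k0 [Qn kn max] nE m Qm nm.
have -> : m = n; last exact: dvdn_gcdr.
apply/eqP; rewrite eqn_leq nm andbT nE -ltnS.
apply: leq_trans (leqSpred _); rewrite ltnNge.
by apply: contra Qm => /leq_sizeP ->.
Qed.

(** An implication is enough on the right: tops exist on both sides for each [d] and are unique. *)
Lemma type_of_eqP (s t : param R k l) : (1 < k)%N -> setB s.2 -> setB t.2 ->
  type_of s = type_of t <->
  (forall d a, (d %| k)%N -> (1 < d)%N ->
     top_nmult d (Qpoly s.2) a -> top_nmult d (Qpoly t.2) a).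
Proof.
move=> k1 Bs Bt; have k0 := ltnW k1.
have ds := setB_degree Bs; have dt := setB_degree Bt.
have is1 := mult_above_degree k0 ds erefl; have it1 := mult_above_degree k0 dt erefl.
have Ts d := setB_top_nmult (d := d) Bs; have Tt d := setB_top_nmult (d := d) Bt.
have g0 n : (0 < gcdn k n)%N by rewrite gcdn_gt0 k0.
rewrite /type_of; split=> [[en et] d a dk d1 ta|h].
  rewrite -en in dt it1 et.
  have [dn|dn] := boolP (d %| (size (Qpoly s.2)).-1)%N.
    apply: (type_tail_top_nmult (fuel := k) _ _ _ _ is1 it1 et) ta => //.
    - by rewrite g0 ltnW// ltnS dvdn_leq ?dvdn_gcdl.
    - exact: dvdn_gcdl.
    - by rewrite dvdn_gcd dk.
  have up Q n : ~~ (d %| n)%N -> top_nmult k Q n -> top_nmult d Q n.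
    move=> dn' [Qn _ max]; split=> // m Qm dm; apply: max => //.
    by apply: contra dm; exact: dvdn_trans.
  by rewrite -(top_nmult_uniq (up _ _ dn ds) ta); exact: up dt.
have en := top_nmult_uniq (h _ _ (dvdnn k) k1 ds) dt.
rewrite -en in it1 *; congr cons; apply: type_tail_eq => //.
exact: dvdn_gcdl.
Qed.

End TypeCombinatorics.

(** * The dominant term *)

Section Growth.
Variables (R : realType) (k : nat).
Hypothesis k_gt1 : (1 < k)%N.

Lemma mul_pred_le_exp2 n : (n * n.-1 <= 2 ^ n)%N.
Proof.
have dbl m : (m.*2 <= 2 ^ m)%N.
  elim: m => [|[|m] IHm] //; rewrite expnS mul2n leq_double.
  by apply: leq_trans IHm; rewrite -muln2; lia.
elim: n => [|n IHn] //=; rewrite expnS mul2n -addnn.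
have := dbl n; have : (n.+1 * n <= n * n.-1 + n.*2)%N.
  by rewrite -muln2; case: n {IHn} => //= n; lia.
lia.
Qed.

Lemma double_exp_growth (rho c L : R) : 1 < rho -> 1 <= L ->
  exists J, forall n, (J <= n)%N -> c * n.+1%:R * L ^+ n.+1 <= rho ^+ (k ^ n.-1).
Proof.
move=> rho1 L1.
(* The left side is at most [a^n], as [n + 1 <= 4^n] and [L^(n+1) <= L^(2n)]. With [a <= rho^j] it
   remains that [j n <= k^(n-1)], which holds from [4 j + 2] on. *)
pose a := Num.max c 1 * (4 * L ^+ 2).
have a1 : 1 <= a.
  apply: mulr_ege1; first by rewrite le_max lexx orbT.
  by have := exprn_ege1 2 L1; lra.
have [j jP] : exists j, a <= rho ^+ j.
  exists (Num.truncn ((a - 1) / (rho - 1))).+1.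
  have := truncnS_gt ((a - 1) / (rho - 1)); set t := (_).+1 => ta.
  have d0 : 0 < rho - 1 by lra.
  have bern m : 1 + m%:R * (rho - 1) <= rho ^+ m.
    elim: m => [|m IHm]; first by rewrite mul0r addr0 expr0.
    rewrite exprS -natr1 mulrDl mul1r.
    have : rho * (1 + m%:R * (rho - 1)) <= rho * rho ^+ m by rewrite ler_pM2l//; lra.
    have : 0 <= m%:R * (rho - 1) * (rho - 1) by rewrite !mulr_ge0 ?ler0n// ltW.
    lra.
  apply: le_trans (bern t); rewrite ltr_pdivrMr// in ta; lra.
exists (4 * j).+2 => n Jn.
apply: (@le_trans _ _ (a ^+ n)).
  have n0 : (0 < n)%N by lia.
  rewrite /a exprMn exprMn -exprM mulrA.
  have h1 : c * n.+1%:R <= Num.max c 1 ^+ n * 4 ^+ n.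
    have m1 : 1 <= Num.max c 1 by rewrite le_max lexx orbT.
    apply: le_trans (_ : Num.max c 1 * n.+1%:R <= _).
      by rewrite ler_wpM2r ?ler0n// le_max lexx.
    apply: ler_pM; rewrite ?ler0n ?(le_trans ler01)//.
      by rewrite -[leLHS]expr1 ler_weXn2l.
    by rewrite -natrX ler_nat ltn_expl.
  have h2 : L ^+ n.+1 <= L ^+ (2 * n) by rewrite ler_weXn2l//; lia.
  apply: le_trans (_ : Num.max c 1 ^+ n * 4 ^+ n * L ^+ n.+1 <= _).
    by rewrite ler_wpM2r// exprn_ge0//; lra.
  by rewrite ler_wpM2l// mulr_ge0 ?exprn_ge0// le_max ler01 orbT.
have jn : (j * n <= k ^ n.-1)%N.
  have := mul_pred_le_exp2 n; have n0 : (0 < n)%N by lia.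
  have : (2 ^ n.-1 <= k ^ n.-1)%N by rewrite leq_exp2r//; lia.
  have -> : (2 ^ n = 2 * 2 ^ n.-1)%N by rewrite -expnS prednK.
  have : (4 * j * n <= n * n.-1)%N by rewrite mulnC leq_mul2l; lia.
  lia.
apply: le_trans (_ : rho ^+ (j * n) <= _).
  by rewrite exprM lerXn2r ?nnegrE// (le_trans ler01)// exprn_ege1// ltW.
by rewrite ler_weXn2l// ltW.
Qed.

End Growth.

Section Dominance.
Variables (R : realType) (k l : nat).
Hypotheses (k_gt1 : (1 < k)%N) (l_gt0 : (0 < l)%N).
Local Notation C := (CC R).
Implicit Types (Q : {poly C}) (lam y : C) (e : nat -> C) (n m : nat).

Definition twist_diff Q (u : C) : {poly C} := Q - (Q \Po (u *: 'X)).

(* With [e i] the factor by which a translation multiplies [exp(-k^i w)], *)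
(* this is the displacement of [z], cleared of negative powers of [lam].  *)
Definition displacement lam Q e n : {poly C} :=
  \sum_(i < n.+1) lam ^+ (n - i) *: (twist_diff Q (e i) \Po 'X^(k ^ i)).

Lemma coef_scale_arg Q (u : C) m : (Q \Po (u *: 'X))`_m = Q`_m * u ^+ m.
Proof.
elim/poly_ind: Q m => [|Q c IHQ] m; first by rewrite comp_poly0 !coef0 mul0r.
rewrite comp_polyD comp_polyM comp_polyX comp_polyC !coefD !coefC -scalerAr coefZ !coefMX.
case: m => [|m] /=; first by rewrite mulr0 !add0r mulr1.
by rewrite IHQ !addr0 exprS mulrCA.
Qed.

Lemma coef_twist_diff Q (u : C) m : (twist_diff Q u)`_m = Q`_m * (1 - u ^+ m).
Proof. by rewrite coefB coef_scale_arg mulrBr mulr1. Qed.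

Lemma size_twist_diff Q (u : C) : (size (twist_diff Q u) <= size Q)%N.
Proof. apply/leq_sizeP => m Qm; rewrite coef_twist_diff.
by have /leq_sizeP -> := Qm; rewrite ?mul0r. Qed.

Lemma cabs_twist_diff_coef Q (u : C) m (B : R) : (forall i, cabs Q`_i <= B) ->
  cabs u = 1 -> cabs (twist_diff Q u)`_m <= 2 * B.
Proof.
move=> QB u1; rewrite coef_twist_diff cabsM mulrC.
apply: ler_pM; rewrite ?cabs_ge0//.
apply: le_trans (cabsD _ _) _.
by rewrite cabsN cabs1 cabsX u1 expr1n.
Qed.

Lemma cabs_horner_le (P : {poly C}) (x : C) (B : R) D : (size P <= D)%N ->
  (forall i, cabs P`_i <= B) -> 1 <= cabs x ->
  cabs P.[x] <= D%:R * (B * cabs x ^+ D.-1).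
Proof.
move=> sP PB x1; rewrite (horner_coef_wide _ sP).
apply: le_trans (cabs_sum _ _ _) _.
have -> : D%:R * (B * cabs x ^+ D.-1) = \sum_(i < D) (B * cabs x ^+ D.-1).
  by rewrite sumr_const card_ord mulr_natl.
apply: ler_sum => i _; rewrite cabsM cabsX.
apply: ler_pM => //; rewrite ?exprn_ge0 ?cabs_ge0//.
by rewrite ler_weXn2l//; have := ltn_ord i; lia.
Qed.

Lemma horner_displacement lam Q e n y : (displacement lam Q e n).[y] =
  \sum_(i < n.+1) lam ^+ (n - i) * (Q.[y ^+ (k ^ i)] - Q.[e i * y ^+ (k ^ i)]).
Proof.
rewrite horner_sum; apply: eq_bigr => i _.
rewrite hornerZ horner_comp hornerXn /twist_diff hornerD hornerN horner_comp.
by rewrite hornerZ hornerX.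
Qed.

Definition lower_part lam Q e n : {poly C} :=
  \sum_(i < n) lam ^+ (n - i) *: (twist_diff Q (e i) \Po 'X^(k ^ i)).

Lemma displacementE lam Q e n : displacement lam Q e n =
  lower_part lam Q e n + (twist_diff Q (e n) \Po 'X^(k ^ n)).
Proof. by rewrite /displacement big_ord_recr/= subnn expr0 scale1r. Qed.

(** As [deg Q < l k], the terms of index below [n] have degree at most [(l k - 1) k^(n-1)]. This
    leaves room for the factor [|y|^(k^(n-1))] below the exponent [l k^n <= n0 k^n]. *)
Lemma lower_part_le lam Q e n y (B L : R) n0 : (size Q <= l * k)%N ->
  (forall i, cabs Q`_i <= B) -> (forall i, cabs (e i) = 1) ->
  1 <= L -> cabs lam <= L -> 1 <= cabs y -> (l <= n0)%N ->
  cabs (lower_part lam Q e n).[y] * cabs y ^+ (k ^ n.-1) <=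
  2 * B * (l * k)%:R * n.+1%:R * L ^+ n.+1 * cabs y ^+ (n0 * k ^ n).
Proof.
move=> sQ QB e1 L1 lamL y1 ln0; rewrite horner_sum.
have B0 : 0 <= B := le_trans (cabs_ge0 _) (QB 0%N).
apply: (@le_trans _ _ (\sum_(i < n)
  (L ^+ n.+1 * ((l * k)%:R * (2 * B * cabs y ^+ (n0 * k ^ n)))))); last first.
  rewrite sumr_const card_ord -[leLHS]mulr_natl.
  have -> : 2 * B * (l * k)%:R * n.+1%:R * L ^+ n.+1 * cabs y ^+ (n0 * k ^ n) =
    n.+1%:R * (L ^+ n.+1 * ((l * k)%:R * (2 * B * cabs y ^+ (n0 * k ^ n)))) by ring.
  apply: ler_wpM2r; last by rewrite ler_nat.
  by rewrite !mulr_ge0 ?exprn_ge0 ?cabs_ge0 ?ler0n//; lra.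
apply: le_trans (_ : (\sum_(i < n) cabs (lam ^+ (n - i) *:
    (twist_diff Q (e i) \Po 'X^(k ^ i))).[y]) * cabs y ^+ (k ^ n.-1) <= _).
  by rewrite ler_wpM2r ?exprn_ge0 ?cabs_ge0 ?cabs_sum.
rewrite mulr_suml; apply: ler_sum => i _.
rewrite hornerZ cabsM cabsX horner_comp hornerXn -mulrA.
apply: ler_pM; rewrite ?mulr_ge0 ?exprn_ge0 ?cabs_ge0//.
  apply: le_trans (_ : L ^+ (n - i) <= _); first by rewrite lerXn2r ?nnegrE ?cabs_ge0//; lra.
  by rewrite ler_weXn2l//; lia.
have x1 : 1 <= cabs (y ^+ (k ^ i)) by rewrite cabsX exprn_ege1.
have bd := cabs_horner_le (leq_trans (size_twist_diff Q (e i)) sQ)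
  (fun m => cabs_twist_diff_coef m QB (e1 i)) x1.
apply: le_trans (ler_wpM2r _ bd) _; first by rewrite exprn_ge0 ?cabs_ge0.
rewrite -!mulrA; apply: ler_wpM2l => //; apply: ler_wpM2l => //.
apply: ler_wpM2l => //; rewrite cabsX -exprM -exprD ler_weXn2l//.
have nE : n = n.-1.+1 by have := ltn_ord i; lia.
have h1 : (k ^ i <= k ^ n.-1)%N by rewrite leq_exp2l//; have := ltn_ord i; lia.
have h2 : (l * (k * k ^ n.-1) <= n0 * k ^ n)%N by rewrite -expnS -nE leq_mul2r ln0 orbT.
apply: leq_trans h2.
apply: (@leq_trans (k ^ n.-1 * (l * k).-1 + k ^ n.-1)%N).
  by rewrite leq_add2r leq_mul2r h1 orbT.
by rewrite -mulnSr prednK ?muln_gt0 ?l_gt0 ?(ltnW k_gt1)//; lia.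
Qed.

(** [J] depends on the bounds only, which makes the estimate uniform on compact sets and near a
    parameter. The lower indices take up at most 1/8 of the main term and the other terms of index
    [n] at most 1/4. *)
Lemma dominant_term (rho B L beta : R) : 1 < rho -> 1 <= L -> 0 < beta ->
  exists J, forall n lam Q e n0 y, (J <= n)%N ->
  (size Q <= l * k)%N -> (forall i, cabs Q`_i <= B) ->
  (forall i, cabs (e i) = 1) -> cabs lam <= L -> rho <= cabs y -> (l <= n0)%N ->
  let P := twist_diff Q (e n) in
  beta <= cabs P`_n0 ->
  (forall m, (n0 < m)%N ->
    8 * (l * k)%:R * (cabs P`_m * cabs y ^+ (m * k ^ n)) <=
    cabs P`_n0 * cabs y ^+ (n0 * k ^ n)) ->
  cabs ((displacement lam Q e n).[y] - P`_n0 * y ^+ (n0 * k ^ n)) <=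
  cabs P`_n0 * cabs y ^+ (n0 * k ^ n) / 2.
Proof.
move=> rho1 L1 beta0.
have [J JP] := double_exp_growth k_gt1 (8 * (2 * B * (l * k)%:R) / beta) rho1 L1.
exists J => n lam Q e n0 y Jn sQ QB e1 lamL ry ln0 P bP hi.
have y1 : 1 <= cabs y by lra.
have B0 : 0 <= B := le_trans (cabs_ge0 _) (QB 0%N).
have g := JP n Jn.
set r := cabs y in ry y1 hi *.
have g' : 8 * (2 * B * (l * k)%:R) * n.+1%:R * L ^+ n.+1 <= beta * r ^+ (k ^ n.-1).
  rewrite -ler_pdivrMl// mulrC.
  apply: le_trans (_ : rho ^+ (k ^ n.-1) <= _); last by rewrite lerXn2r ?nnegrE//; lra.
  by apply: le_trans g; rewrite le_eqVlt; apply/orP; left; apply/eqP; ring.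
set T := r ^+ (n0 * k ^ n) in hi *.
have T0 : 0 < T by rewrite exprn_gt0//; lra.
have low : 8 * cabs (lower_part lam Q e n).[y] <= cabs P`_n0 * T.
  have := lower_part_le n sQ QB e1 L1 lamL y1 ln0.
  set S := r ^+ (k ^ n.-1); rewrite -/r -/S -/T => lo.
  have S0 : 0 < S by rewrite exprn_gt0//; lra.
  rewrite -(ler_pM2r S0).
  apply: le_trans (_ : 8 * (2 * B * (l * k)%:R * n.+1%:R * L ^+ n.+1 * T) <= _).
    by rewrite -[8 * _ * S]mulrA ler_wpM2l.
  apply: le_trans (_ : beta * S * T <= _); last first.
    by rewrite [beta * S * T]mulrAC !ler_wpM2r// ltW.
  by have := ler_wpM2r (ltW T0) g'; rewrite !mulrA.
rewrite displacementE hornerD horner_comp hornerXn -addrA -/P.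
set x := y ^+ (k ^ n).
have -> : y ^+ (n0 * k ^ n) = x ^+ n0 by rewrite mulnC exprM.
have sP : (size P <= l * k)%N := leq_trans (size_twist_diff _ _) sQ.
have rest : cabs (P.[x] - P`_n0 * x ^+ n0) <= cabs P`_n0 * T / 4.
  have [P0|P0] := eqVneq (P`_n0) 0; first by move: bP; rewrite P0 cabs0; lra.
  have n0l : (n0 < l * k)%N.
    rewrite ltnNge; apply: contra P0 => h; have /leq_sizeP -> // := leq_trans sP h.
  rewrite (horner_coef_wide _ sP) (bigD1 (Ordinal n0l))//= addrAC subrr add0r.
  apply: le_trans (cabs_sum _ _ _) _.
  (* Exponents above [n0] are controlled by hypothesis; those below lose a factor [|y|^(k^n)], large
     against the coefficient bounds. *)
  apply: (@le_trans _ _ (\sum_(i < l * k | i != Ordinal n0l) cabs P`_n0 * T / (4 * (l * k)%:R))).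
    apply: ler_sum => i i0; rewrite cabsM /x -exprM cabsX -/r.
    have lk0 : (0 : R) < (l * k)%:R by rewrite ltr0n muln_gt0 l_gt0 ltnW.
    rewrite ler_pdivlMr ?mulr_gt0//.
    have [ni|ni] := ltnP n0 i.
      have := hi i ni; rewrite [(i * _)%N]mulnC.
      have : 0 <= cabs P`_i * r ^+ (k ^ n * i) by rewrite mulr_ge0 ?cabs_ge0 ?exprn_ge0//; lra.
      set X := cabs _ * _ => X0; set K := (l * k)%:R in lk0 *.
      have : 0 <= K * X by rewrite mulr_ge0// ltW.
      lra.
    have {}ni : (i < n0)%N.
      by rewrite ltn_neqAle ni andbT; apply: contra i0 => /eqP ?; apply/eqP/val_inj.
    have cP := cabs_twist_diff_coef i QB (e1 n); rewrite -/P in cP.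
    apply: le_trans (_ : 2 * B * r ^+ (k ^ n * i) * (4 * (l * k)%:R) <= _).
      rewrite ler_wpM2r ?mulr_ge0 ?ler0n//.
      by rewrite ler_wpM2r// exprn_ge0//; lra.
    have g2 : 4 * (2 * B * (l * k)%:R) <= beta * r ^+ (k ^ n).
      apply: le_trans (_ : 8 * (2 * B * (l * k)%:R) * n.+1%:R * L ^+ n.+1 <= _).
        have b0 : 0 <= 2 * B * (l * k)%:R by rewrite !mulr_ge0.
        rewrite -mulrA -[leLHS]mulr1 -mulrA mulrCA -[leRHS]mulrA.
        have nL : 1 <= n.+1%:R * L ^+ n.+1 by rewrite mulr_ege1 ?ler1n ?exprn_ege1.
        nra.
      apply: (le_trans g'); rewrite ler_wpM2l// ?(ltW beta0)// ler_weXn2l//.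
      by rewrite leq_exp2l// leq_pred.
    apply: le_trans (_ : beta * r ^+ (k ^ n) * r ^+ (k ^ n * i) <= _).
      have -> : 2 * B * r ^+ (k ^ n * i) * (4 * (l * k)%:R) =
        4 * (2 * B * (l * k)%:R) * r ^+ (k ^ n * i) by ring.
      by rewrite ler_wpM2r// exprn_ge0//; lra.
    rewrite -mulrA -exprD -mulnS; apply: ler_pM => //; first exact: ltW.
      by rewrite exprn_ge0//; lra.
    by rewrite /T [(n0 * _)%N]mulnC ler_weXn2l// leq_mul2l ni orbT.
  rewrite sumr_const cardC1 card_ord -[leLHS]mulr_natl.
  have lk0 : (0 : R) < (l * k)%:R by rewrite ltr0n muln_gt0 l_gt0 ltnW.
  have PT : 0 <= cabs P`_n0 * T by rewrite mulr_ge0 ?cabs_ge0 ?ltW.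
  apply: le_trans (_ : (l * k)%:R * (cabs P`_n0 * T / (4 * (l * k)%:R)) <= _).
    rewrite ler_wpM2r ?ler_nat ?leq_pred// divr_ge0// mulr_ge0// ltW//.
  move: lk0; move: ((l * k)%:R : R) (cabs _ * T) => K X K0.
  have K1 : K != 0 by rewrite gt_eqF.
  by rewrite le_eqVlt; apply/orP; left; apply/eqP; field.
have := cabsD (lower_part lam Q e n).[y] (P.[x] - P`_n0 * x ^+ n0).
have PT : 0 <= cabs P`_n0 * T by rewrite mulr_ge0 ?cabs_ge0 ?ltW.
lra.
Qed.

End Dominance.

(** * Constant type implies proper discontinuity *)

Section CompactBounds.
Variables (R : realType) (E : topologicalType).

Lemma finite_pos (T : eqType) (s : seq T) (P : T -> R -> Prop) :
  (forall x a b, b <= a -> P x a -> P x b) ->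
  (forall x, x \in s -> exists2 a, 0 < a & P x a) ->
  exists2 a, 0 < a & forall x, x \in s -> P x a.
Proof.
move=> mono; elim: s => [|x s IHs] ex; first by exists 1.
have [y ys|a a0 aP] := IHs; first by apply: ex; rewrite inE ys orbT.
have [b b0 bP] := ex x (mem_head _ _).
exists (Num.min a b); first by rewrite lt_min a0.
move=> y; rewrite inE => /orP[/eqP->|/aP].
  by apply: mono bP; rewrite ge_min lexx orbT.
by apply: mono; rewrite ge_min lexx.
Qed.

Lemma compact_upper_bound (K : set E) (f : E -> R) : compact K ->
  (forall p, K p -> {for p, continuous f}) ->
  exists2 B, 0 < B & forall p, K p -> f p <= B.
Proof.
move=> cK cf.
have cf' : {within K, continuous f}.
  by apply: continuous_in_subspaceT => p; rewrite inE; exact: cf.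
have /compact_bounded[M [_ MP]] := continuous_compact cf' cK.
exists (Num.max 1 (M + 1)); first by rewrite lt_max ltr01.
move=> p Kp; rewrite le_max; apply/orP; right.
apply: le_trans (ler_norm _) _; apply: (MP (M + 1)); first by rewrite ltrDl.
by exists p.
Qed.

Lemma compact_lower_bound (K : set E) (f : E -> R) : compact K ->
  (forall p, K p -> {for p, continuous f}) -> (forall p, K p -> 0 < f p) ->
  exists2 a, 0 < a & forall p, K p -> a <= f p.
Proof.
move=> cK cf f0.
have [p Kp|B B0 BP] := @compact_upper_bound K (fun p => (f p)^-1) cK.
  by apply: cvgV; [rewrite gt_eqF// f0 | exact: cf].
exists B^-1; first by rewrite invr_gt0.
by move=> p Kp; rewrite invf_ple ?posrE// ?f0//; exact: BP.
Qed.

End CompactBounds.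

Section Displacement.
Variables (R : realType) (k l : nat).
Hypothesis k_gt1 : (1 < k)%N.
Local Notation C := (CC R).
Local Notation ambient := (ambient R k l).

Definition root_of_unity (s : int) : C := cexp ((s%:~R / k%:R : R)%:C%C * tpi R).

Lemma root_of_unityM (q s : int) : root_of_unity (q * k + s) = root_of_unity s.
Proof.
rewrite /root_of_unity intrD mulrDl intrM -[(k : int)%:~R]/(k%:R : R).
rewrite mulfK ?pnatr_eq0 -?lt0n ?(ltnW k_gt1)//.
rewrite rmorphD mulrDl addrC -[RHS](cexp_periodic _ q) rmorph_int//.
Qed.

Lemma root_of_unity_modz (s : int) : root_of_unity s = root_of_unity (s %% k)%Z.
Proof. by rewrite {1}(divz_eq s k) root_of_unityM. Qed.

Lemma root_of_unity_eq1 (s : int) : (k %| s)%Z -> root_of_unity s = 1.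
Proof.
move=> /dvdz_mod0P ks; rewrite root_of_unity_modz ks.
by rewrite /root_of_unity mul0r mul0r cexp0.
Qed.

(** Only the finitely many nonzero residues modulo [k] matter. *)
Lemma root_of_unity_gap : exists2 a : R, 0 < a &
  forall s : int, ~~ (k %| s)%Z -> a <= cabs (1 - root_of_unity s).
Proof.
have kR : (0 : R) < k%:R by rewrite ltr0n ltnW.
have [||a a0 aP] := @finite_pos R nat (iota 1 k.-1)
    (fun i a => a <= cabs (1 - root_of_unity i)).
- by move=> x a b ba; exact: le_trans.
- move=> i; rewrite mem_iota => /andP[i1 ik].
  exists (cabs (1 - root_of_unity i)) => //.
  rewrite cabs_gt0 subr_eq0 eq_sym; apply: cexp_tpi_neq1.
  rewrite divr_gt0 ?ltr0z//= ltr_pdivrMr// mul1r -[(i : int)%:~R]/(i%:R) ltr_nat.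
  lia.
exists a => // s ks; rewrite root_of_unity_modz.
have k0 : (k : int) != 0 by lia.
have := modz_ge0 s k0; have := ltz_pmod s (d := k); have := dvdz_mod0P (d := k) (m := s).
case: (s %% k)%Z => // i ki ik _; apply: aP; rewrite mem_iota.
have i0 : i != 0%N by apply: contra ks => /eqP e; apply/ki; rewrite e.
have k00 : (0 : int) < k by lia.
by have := ik k00; lia.
Qed.

Definition rotation (a : rat) (i : nat) : C := cexp (- (k%:R ^+ i * (ratr a * tpi R))).

Lemma ratrC (a : rat) : (ratr a : C) = (ratr a)%:C%C.
Proof. by rewrite (fmorph_rat (real_complex R)). Qed.

Lemma cabs_rotation a i : cabs (rotation a i) = 1.
Proof.
rewrite cabs_cexp Re_oppC -natrX Re_natM ratrC tpiM/= mulr0 oppr0.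
exact: expR0.
Qed.

Lemma rotation_root_of_unity a n (c : int) m : a * k%:R ^+ n.+1 = c%:~R ->
  rotation a n ^+ m = root_of_unity (- (m%:Z * c)).
Proof.
move=> ac; have kq : (k%:R : rat) != 0 by rewrite pnatr_eq0 -lt0n ltnW.
have e : a * k%:R ^+ n = c%:~R / k%:R :> rat by rewrite -ac exprSr mulrA mulfK.
have {}e : k%:R ^+ n * ratr a = (c%:~R / k%:R : R)%:C%C :> C.
  have := congr1 (ratr : rat -> C) e.
  rewrite !rmorphM/= fmorphV rmorphXn/= !ratr_nat ratr_int mulrC => ->.
  by rewrite fmorphV rmorph_nat rmorph_int.
rewrite -cexpMn /root_of_unity; congr cexp.
rewrite [k%:R ^+ n * _]mulrA e.
have -> : (- (m%:Z * c))%:~R / k%:R = - (m%:R * (c%:~R / k%:R)) :> R.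
  by rewrite rmorphN rmorphM/= mulNr mulrA.
by rewrite [in RHS]rmorphN [in RHS]rmorphM/= rmorph_nat mulrN mulNr mulrA.
Qed.

Lemma cexp_shift_pow (w : C) i : cexp (- (k%:R ^+ i * w)) = cexp (- w) ^+ (k ^ i).
Proof. by rewrite -cexpMn natrX mulrN. Qed.

(** Both series may be truncated at order [n + 1], since [k^(n+1) a] is an integer. *)
Lemma act_translation (a : rat) n (p : ambient) : p.2.1.1 != 0 ->
  a * k%:R ^+ n.+1 \is a Num.int ->
  p.2.1.1 ^+ n.+1 * ((act (0, a) p).1.1 - p.1.1) =
  (displacement k p.2.1.1 (Qpoly p.2.2) (rotation a) n).[cexp (- p.1.2)].
Proof.
move=> l0 an; have L : levels k (0, a) (n.+1, n.+1) by split=> //=; rewrite addr0.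
rewrite (actE k_gt1 l0 L) /act_at /= expr0z !mul1r mul0r addr0 addrAC subrr add0r.
rewrite horner_displacement /twist -sumrB mulr_sumr; apply: eq_bigr => i _.
rewrite -mulrBr mulrA; congr (_ * (_ - _)).
- have exprB j : (j <= n)%N -> p.2.1.1 ^+ n.+1 / p.2.1.1 ^+ j.+1 = p.2.1.1 ^+ (n - j).
    by move=> jn; rewrite -{1}(subnK jn) -addnS exprD mulfK ?expf_neq0.
  by rewrite exprB// -ltnS.
- by rewrite cexp_shift_pow.
- rewrite /base_move/= expr0z mul1r mulrDr opprD cexpD cexp_shift_pow mulrC.
  by [].
Qed.

End Displacement.

Section ConstantType.
Variables (R : realType) (k l : nat).
Hypotheses (k_gt1 : (1 < k)%N) (l_gt0 : (0 < l)%N).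
Local Notation C := (CC R).
Local Notation ambient := (ambient R k l).
Local Notation act := (act (R := R) (k := k) (l := l)).

Lemma dvdn_reduce (c m : nat) : (k %| m * c)%N = (k %/ gcdn k c %| m)%N.
Proof.
have g0 : (0 < gcdn k c)%N by rewrite gcdn_gt0 ltnW.
have cop : coprime (k %/ gcdn k c) (c %/ gcdn k c).
  by rewrite /coprime -(eqn_pmul2r g0) muln_gcdl !divnK ?dvdn_gcdl ?dvdn_gcdr// mul1n.
rewrite -[X in (X %| _)%N = _](divnK (dvdn_gcdl k c)).
rewrite -[X in (_ %| m * X)%N](divnK (dvdn_gcdr k c)) mulnA.
by rewrite dvdn_pmul2r// Gauss_dvdl.
Qed.

Lemma continuous_lam (p : ambient) : {for p, continuous (fun q : ambient => cabs q.2.1.1)}.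
Proof.
apply: (@continuous_comp _ _ _ (fun q : ambient => q.2.1.1) (@cabs R)).
  apply: differentiable_continuous.
  apply: (differentiable_comp (f := fun q : ambient => q.2.1) (g := fst)).
    apply: (differentiable_comp (g := fst)); first exact: differentiable_snd.
    exact: differentiable_fst.
  exact: differentiable_fst.
exact: continuous_cabs.
Qed.

Lemma continuous_z (p : ambient) : {for p, continuous (fun q : ambient => cabs q.1.1)}.
Proof.
apply: (@continuous_comp _ _ _ (fun q : ambient => q.1.1) (@cabs R)).
  apply: differentiable_continuous.
  apply: (differentiable_comp (g := fst)); first exact: differentiable_fst.
  exact: differentiable_fst.
exact: continuous_cabs.
Qed.

Lemma continuous_w (p : ambient) : {for p, continuous (fun q : ambient => q.1.2)}.
Proof.
apply: differentiable_continuous.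
apply: (differentiable_comp (g := snd)); first exact: differentiable_fst.
exact: differentiable_snd.
Qed.

Lemma continuous_cabs_w (p : ambient) : {for p, continuous (fun q : ambient => cabs q.1.2)}.
Proof.
apply: (@continuous_comp _ _ _ (fun q : ambient => q.1.2) (@cabs R)).
  exact: continuous_w.
exact: continuous_cabs.
Qed.

Lemma continuous_Re_w (p : ambient) :
  {for p, continuous (fun q : ambient => - complex.Re q.1.2)}.
Proof.
apply: continuousN.
apply: (@continuous_comp _ _ _ (fun q : ambient => q.1.2) (fun w : C => complex.Re w)).
  exact: continuous_w.
exact: continuous_Re.
Qed.

Lemma continuous_coef m (t : param R k l) :
  {for t, continuous (fun s : param R k l => cabs (Qpoly s.2)`_m)}.
Proof.
apply: (@continuous_comp _ _ _ (fun s : param R k l => (Qpoly s.2)`_m) (@cabs R)).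
  apply: differentiable_continuous.
  rewrite (_ : (fun s => _) = fun s : param R k l =>
    \sum_(i < l * k - l) (if (m == l + i)%N then s.2 0 i else 0)); last first.
    by apply/funext => s; rewrite Qpoly_coef.
  apply: differentiable_bigsum => i; case: eqP => _; last exact: differentiable_cst.
  apply: (differentiable_comp (f := fun q : param R k l => q.2) (g := fun b => b 0 i)).
    exact: differentiable_snd.
  exact: differentiable_coord.
exact: continuous_cabs.
Qed.

Lemma continuous_coef_ambient m (p : ambient) :
  {for p, continuous (fun q : ambient => cabs (Qpoly q.2.2)`_m)}.
Proof.
apply: (@continuous_comp _ _ _ (fun q : ambient => q.2)
  (fun s : param R k l => cabs (Qpoly s.2)`_m)).
  exact/differentiable_continuous/differentiable_snd.
exact: continuous_coef.
Qed.

Lemma compact_coef_bound (K : set ambient) : compact K ->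
  exists2 B, 0 < B & forall p m, K p -> cabs (Qpoly p.2.2)`_m <= B.
Proof.
move=> cK.
(* [finite_pos] yields a common lower bound, so it is applied to inverses of the upper bounds. *)
have [||a a0 aP] := @finite_pos R nat (iota 0 (l * k))
   (fun m a => forall p, K p -> cabs (Qpoly p.2.2)`_m * a <= 1).
- by move=> m a b ba aP p Kp; apply: le_trans (aP p Kp); rewrite ler_wpM2l// cabs_ge0.
- move=> m _; have [B B0 BP] := compact_upper_bound cK (fun p _ => @continuous_coef_ambient m p).
  exists B^-1; first by rewrite invr_gt0.
  by move=> p Kp; rewrite ler_pdivrMr// mul1r; exact: BP.
exists a^-1; first by rewrite invr_gt0.
move=> p m Kp; have [->|Qm] := eqVneq (Qpoly p.2.2)`_m 0.
  by rewrite cabs0 invr_ge0 ltW.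
rewrite -[leRHS]mul1r ler_pdivlMr//; apply: aP => //.
by rewrite mem_iota add0n; have /andP[] := Qpoly_range Qm.
Qed.

(** A return forces [|lam^(n+1) (z' - z)| <= 2 Z L^(n+1)], whereas by [dominant_term] the
    displacement is at least of the order of [rho^(k^(n-1))], with [rho = exp r1 > 1]. *)
Lemma no_return_deep (T : set (param R k l)) (K : set ambient) (t0 : param R k l) :
  T `<=` @setAB R k l -> T t0 ->
  (forall s t, T s -> T t -> type_of s = type_of t) ->
  K `<=` fibered_over T -> compact K ->
  exists J, forall n a (c : int) p, (J <= n)%N -> a * k%:R ^+ n.+1 = c%:~R ->
    ~~ (k %| c)%Z -> K p -> K (act (0, a) p) -> False.
Proof.
move=> TAB Tt0 cst KT cK.
have KTp p : K p -> T p.2 by move=> /KT[].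
have lam0 p : K p -> p.2.1.1 != 0 by move=> /KTp/TAB[[]].
have [Z Z0 ZP] := compact_upper_bound cK (fun p _ => @continuous_z p).
have [L0 L00 L0P] := compact_upper_bound cK (fun p _ => @continuous_lam p).
pose L := Num.max 1 L0.
have L1 : 1 <= L by rewrite le_max lexx.
have LP p : K p -> cabs p.2.1.1 <= L by move=> Kp; rewrite le_max L0P// orbT.
have [B B0 BP] := compact_coef_bound cK.
have [r1 r10 r1P] : exists2 r1, 0 < r1 & forall p, K p -> r1 <= - complex.Re p.1.2.
  apply: compact_lower_bound cK _ _ => p Kp; first exact: continuous_Re_w.
  by rewrite oppr_gt0; have [] := KT p Kp.
have rho1 : 1 < expR r1 by rewrite -[1]expR0 ltr_expR.
have yP p : K p -> expR r1 <= cabs (cexp (- p.1.2)).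
  by move=> Kp; rewrite cabs_cexp Re_oppC ler_expR r1P.
have [dlt dlt0 dltP] := root_of_unity_gap R k_gt1.
(* Constancy of the type makes the top coefficient for each [d] nonzero all over [K], hence bounded
   below by compactness. *)
have [bt bt0 btP] : exists2 bt, 0 < bt & forall d, d \in divisors k ->
    (1 < d)%N -> forall n p, K p -> top_nmult d (Qpoly t0.2) n -> bt <= cabs (Qpoly p.2.2)`_n.
  apply: finite_pos => [d a b ba aP d1 n p Kp dn|d].
    by apply: le_trans ba _; exact: aP.
  rewrite -dvdn_divisors ?(ltnW k_gt1)// => dk.
  have [d1|d1] := leqP d 1; first by exists 1.
  have [n tn] := setB_top_nmult (proj2 (TAB _ Tt0)) dk d1.
  have [||a a0 aP] := compact_lower_bound (f := fun p : ambient => cabs (Qpoly p.2.2)`_n) cK.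
  - by move=> p _; exact: continuous_coef_ambient.
  - move=> p Kp; rewrite cabs_gt0.
    have /(type_of_eqP k_gt1 (proj2 (TAB _ Tt0)) (proj2 (TAB _ (KTp _ Kp)))) h :=
      cst _ _ Tt0 (KTp _ Kp).
    by have [] := h _ _ dk d1 tn.
  exists a => // _ n' p Kp tn'; rewrite (top_nmult_uniq tn' tn); exact: aP.
have beta0 : 0 < bt * dlt by rewrite mulr_gt0.
have [J1 J1P] := dominant_term k_gt1 l_gt0 B rho1 L1 beta0.
have [J2 J2P] := double_exp_growth k_gt1 (4 * Z / (bt * dlt) + 1) rho1 L1.
exists (maxn J1 J2) => n a c p; rewrite geq_max => /andP[n1 n2] ac kc Kp Kap.
have an : a * k%:R ^+ n.+1 \is a Num.int by rewrite ac; exact: intr_int.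
have := act_translation k_gt1 (lam0 _ Kp) an.
set lam := p.2.1.1; set Q := Qpoly p.2.2; set y := cexp _ => FE.
(* In index [n], the translation kills exactly the exponents divisible by this [d]. *)
pose d := (k %/ gcdn k `|c|)%N.
have dE m : (k %| m%:Z * c)%Z = (d %| m)%N by rewrite dvdzE abszM dvdn_reduce.
have dk : (d %| k)%N.
  by apply/dvdnP; exists (gcdn k `|c|); rewrite mulnC divnK// dvdn_gcdl.
have d1 : (1 < d)%N.
  rewrite ltnNge; apply: contra kc => d1.
  rewrite -[c]mul1r dE dvdn1 eqn_leq d1 lt0n; apply: contraTN dk => /eqP->.
  by rewrite dvd0n -lt0n ltnW.
have /(type_of_eqP k_gt1 (proj2 (TAB _ Tt0)) (proj2 (TAB _ (KTp _ Kp)))) h :=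
      cst _ _ Tt0 (KTp _ Kp).
have [n0 tn0] := setB_top_nmult (proj2 (TAB _ Tt0)) dk d1.
have [Qn0 dn0 maxn0] := h _ _ dk d1 tn0.
have eE m : rotation R k a n ^+ m = root_of_unity R k (- (m%:Z * c)).
  exact: rotation_root_of_unity.
have P0 m : (d %| m)%N -> (twist_diff Q (rotation R k a n))`_m = 0.
  move=> dm; rewrite coef_twist_diff eE root_of_unity_eq1 ?subrr ?mulr0//.
  by rewrite rpredN dE.
have Phi m : (n0 < m)%N -> (twist_diff Q (rotation R k a n))`_m = 0.
  move=> n0m; have [/P0//|dm] := boolP (d %| m)%N.
  have [Qm|Qm] := eqVneq Q`_m 0; first by rewrite coef_twist_diff Qm mul0r.
  by have := maxn0 _ Qm dm; rewrite leqNgt n0m.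
have Pn0 : bt * dlt <= cabs (twist_diff Q (rotation R k a n))`_n0.
  rewrite coef_twist_diff cabsM eE; apply: ler_pM; try exact: ltW.
    by apply: (btP d) => //; rewrite -dvdn_divisors// ltnW.
  by apply: dltP; rewrite rpredN dE.
have /andP[ln0 _] := Qpoly_range Qn0.
have dom := J1P n lam Q (rotation R k a) n0 y n1 (size_Qpoly _) (fun i => BP p i Kp)
  (cabs_rotation R k a) (LP p Kp) (yP p Kp) ln0 Pn0.
have g := J2P n n2.
move: dom; rewrite -FE => dom.
have {}dom : cabs (lam ^+ n.+1 * ((act (0, a) p).1.1 - p.1.1) -
    (twist_diff Q (rotation R k a n))`_n0 * y ^+ (n0 * k ^ n)) <=
    cabs (twist_diff Q (rotation R k a n))`_n0 * cabs y ^+ (n0 * k ^ n) / 2.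
  apply: dom => m n0m; rewrite Phi// cabs0 mul0r mulr0.
  by rewrite mulr_ge0 ?exprn_ge0 ?cabs_ge0.
have up : cabs (lam ^+ n.+1 * ((act (0, a) p).1.1 - p.1.1)) <= L ^+ n.+1 * (2 * Z).
  rewrite cabsM cabsX; apply: ler_pM; rewrite ?exprn_ge0 ?cabs_ge0//.
    by rewrite lerXn2r ?nnegrE ?cabs_ge0 ?LP//; lra.
  apply: le_trans (cabsD _ _) _; rewrite cabsN.
  by have := ZP _ Kp; have := ZP _ Kap; lra.
have yn : expR r1 ^+ (k ^ n.-1) <= cabs y ^+ (n0 * k ^ n).
  have y1 : 1 <= cabs y by have := yP p Kp; rewrite -/y; lra.
  apply: le_trans (_ : cabs y ^+ (k ^ n.-1) <= _).
    by rewrite lerXn2r ?nnegrE ?expR_ge0 ?cabs_ge0// yP.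
  rewrite ler_weXn2l//; apply: (@leq_trans (k ^ n)); first by rewrite leq_exp2l// leq_pred.
  by rewrite leq_pmull// (leq_trans l_gt0).
have tri := cabsB ((twist_diff Q (rotation R k a n))`_n0 * y ^+ (n0 * k ^ n))
  ((twist_diff Q (rotation R k a n))`_n0 * y ^+ (n0 * k ^ n) -
   lam ^+ n.+1 * ((act (0, a) p).1.1 - p.1.1)).
have PYE : cabs ((twist_diff Q (rotation R k a n))`_n0 * y ^+ (n0 * k ^ n)) =
  cabs (twist_diff Q (rotation R k a n))`_n0 * cabs y ^+ (n0 * k ^ n).
  by rewrite cabsM cabsX.
rewrite subKr cabs_distC PYE in tri.
move: dom up tri Pn0 yn g.
set P := cabs (twist_diff _ _)`_n0; set Y := cabs y ^+ _; set V := cabs (_ - _).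
set U := cabs (lam ^+ _ * _); set X := expR r1 ^+ _; set G := L ^+ n.+1.
set bd := bt * dlt in beta0 *.
move=> dom up tri Pn0 yn g.
have G1 : 1 <= G by rewrite exprn_ege1.
have X0 : 0 < X by rewrite exprn_gt0// expR_gt0.
have PY : bd * X <= P * Y by apply: ler_pM => //; exact: ltW.
have gX : (4 * Z / bd + 1) * G <= X.
  apply: le_trans g; rewrite [leRHS]mulrAC ler_peMr ?ler1n//.
  rewrite mulr_ge0 ?(le_trans ler01 G1)// addr_ge0// divr_ge0 ?(ltW beta0)//.
  by rewrite mulr_ge0// ltW.
have : bd * ((4 * Z / bd + 1) * G) <= bd * X by rewrite ler_pM2l.
have -> : bd * ((4 * Z / bd + 1) * G) = (4 * Z + bd) * G.
  by field; rewrite gt_eqF.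
have : 0 < bd * G by rewrite mulr_gt0//; lra.
lra.
Qed.

Lemma finite_int_ball (C0 : nat) : finite_set [set c : int | (absz c <= C0)%N].
Proof.
apply: (@sub_finite_set _ _ ((fun i : nat => i%:Z - C0%:Z) @` `I_(C0 + C0).+1)); last first.
  by apply: finite_image; exact: finite_II.
by move=> c /= cC; exists (absz (c + C0%:Z)); rewrite /=; lia.
Qed.

(** [no_return_deep] bounds the denominator of [a] by [k^(J+1)], and the imaginary part of [w]
    bounds [|a|]. *)
Lemma translations_finite (T : set (param R k l)) (K : set ambient) :
  T `<=` @setAB R k l -> (forall s t, T s -> T t -> type_of s = type_of t) ->
  K `<=` fibered_over T -> compact K ->
  finite_set [set a : rat | ZZk k (0, a) /\ (act (0, a) @` K) `&` K !=set0].
Proof.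
move=> TAB cst KT cK.
have [K0|/set0P[p0 Kp0]] := eqVneq K set0.
  apply: (@sub_finite_set _ _ set0) => // a [_].
  by rewrite K0 setI0 => -[].
have [_ Tp0] := KT _ Kp0.
have [J JP] := no_return_deep TAB Tp0 cst KT cK.
have [W W0 WP] := compact_upper_bound cK (fun p _ => @continuous_cabs_w p).
have k0 : (0 : rat) < k%:R ^+ J.+1 by rewrite exprn_gt0// ltr0n ltnW.
pose C0 := Num.truncn (W * k%:R ^+ J.+1).
apply: (@sub_finite_set _ _ ((fun c : int => c%:~R / k%:R ^+ J.+1) @`
  [set c : int | (absz c <= C0)%N])); last first.
  by apply: finite_image; exact: finite_int_ball.
move=> a [[m am] [_ [[p Kp <-] Kap]]].
have [c ac] : exists c : int, a * k%:R ^+ J.+1 = c%:~R.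
  have exN : exists N : nat, a * k%:R ^+ N \is a Num.int by exists m.
  (* With the least exponent [N], the numerator is not divisible by [k] unless [N = 0]. *)
  have [N aN min] := ex_minnP exN.
  have [NJ|NJ] := leqP N J.+1.
    apply/intrP; rewrite -(subnKC NJ) exprD mulrA rpredM// -natrX natr_int//.
  have /intrP[c cE] := aN.
  case: N aN min NJ cE => // n _ min nJ cE; exfalso.
  apply: (JP n a c p) => //; first exact: ltnW.
  apply/negP => /dvdzP[q qE].
  have : a * k%:R ^+ n \is a Num.int.
    apply/intrP; exists q.
    have kq : (k%:R : rat) != 0 by rewrite pnatr_eq0 -lt0n ltnW.
    apply: (mulIf kq); rewrite -mulrA -exprSr cE qE intrM; congr (_ * _).
  by move=> /min; rewrite ltnn.
exists c; last by rewrite -ac mulfK// gt_eqF.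
have aW : `|ratr a : R| <= W.
  have h1 := WP _ Kp; have h2 := WP _ Kap.
  have i1 := le_trans (cabs_Im _) h1; have := le_trans (cabs_Im _) h2.
  rewrite act_base Im_base_move/= expr0z mul1r => i2.
  have pi2 := pi_ge2 R.
  move: i1 i2; rewrite !ler_norml => /andP[? ?] /andP[? ?]; apply/andP; split; nra.
rewrite /= /C0 truncn_ge_nat; last by rewrite mulr_ge0// ?exprn_ge0// ltW.
have := congr1 (ratr : rat -> R) ac; rewrite rmorphM rmorphXn/= ratr_nat ratr_int => cE.
have -> : (absz c)%:R = `|c%:~R : R| by rewrite natr_absz intr_norm.
rewrite -cE normrM [ `|k%:R ^+ _|]ger0_norm ?exprn_ge0//.
by rewrite ler_wpM2r// exprn_ge0.
Qed.

Lemma constant_type_prop_discontinuous (T : set (param R k l)) :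
  T `<=` @setAB R k l -> (forall s t, T s -> T t -> type_of s = type_of t) ->
  prop_discontinuous (ZZk k) act (fibered_over T).
Proof.
move=> TAB cst K KT cK.
have KA p : K p -> setA p.2.1 by move=> /KT[_ /TAB[]].
have lam0 p : K p -> p.2.1.1 != 0 by move=> /KA[].
have [W W0 WP] := compact_upper_bound cK (fun p _ => @continuous_cabs_w p).
have [r1 r10 r1P] : exists2 r1, 0 < r1 & forall p, K p -> r1 <= - complex.Re p.1.2.
  apply: compact_lower_bound cK _ _ => p Kp; first exact: continuous_Re_w.
  by rewrite oppr_gt0; have [] := KT p Kp.
(* The real part of [w] bounds [n]. For fixed [n], [(n, a) = (0, a) (n, 0)], so a return of [(n, a)]
   to [K] is a return of the translation by [a] to this larger compact set. *)
pose Kn (n : int) := K `|` act (n, 0) @` K.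
pose F (n : int) := pair n @` [set a : rat | ZZk k (0, a) /\ (act (0, a) @` Kn n) `&` Kn n !=set0].
have zn (n : int) : ZZk k (n, 0) by exists 0%N; rewrite /= mul0r.
apply: (@sub_finite_set _ _ (\bigcup_(n in [set n : int | (absz n <= Num.truncn (W / r1))%N]) F n)).
  move=> [n a] [zna [_ [[p Kp <-] Kp']]].
  have za : ZZk k (0, a) by [].
  exists n; last first.
    exists a => //; split=> //; exists (act (n, a) p); split; last by left.
    exists (act (n, 0) p); first by right; exists p.
    rewrite -actM//; last exact: KA.
    by rewrite /ZZk_mul/= add0r mulr0 addr0.
  rewrite /= truncn_ge_nat; last by rewrite divr_ge0// ltW.
  have e := Re_base_move k (n, a) p.1.2; rewrite -act_base/= in e.
  have h1 := r1P _ Kp; have h2 := r1P _ Kp'.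
  have u1 := le_trans (cabs_Re _) (WP _ Kp); have u2 := le_trans (cabs_Re _) (WP _ Kp').
  have kn (j : nat) : (j%:R : R) <= k%:R ^+ j.
    by rewrite -natrX ler_nat ltnW// ltn_expl.
  move: e h1 h2 u1 u2; set x := complex.Re p.1.2; set x' := complex.Re _ => e h1 h2.
  rewrite !ler_norml => /andP[u1 _] /andP[u2 _].
  rewrite ler_pdivlMr//; clearbody x x'; case: n e {zna Kp'} => [j|j] e.
    rewrite -exprnP in e; apply: le_trans (_ : k%:R ^+ j * - x <= _); last lra.
    by apply: ler_pM => //; rewrite ltW.
  have kj := kn j.+1; have kj0 : (0 : R) < k%:R ^+ j.+1 by rewrite exprn_gt0// ltr0n ltnW.
  have ex : x = k%:R ^+ j.+1 * x' by rewrite e NegzE -exprnN mulrA mulfV ?gt_eqF// mul1r.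
  apply: le_trans (_ : k%:R ^+ j.+1 * - x' <= _); last lra.
  by apply: ler_pM => //; rewrite ltW.
apply: bigcup_finite; first exact: finite_int_ball.
move=> n _; apply: finite_image; apply: translations_finite TAB cst _ _.
  by move=> q [/KT//|[p /KT Yp <-]]; exact: act_fibered.
apply: compactU => //; apply: continuous_compact cK.
apply: continuous_in_subspaceT => p; rewrite inE => Kp.
by apply: act_continuous => //; exact: lam0.
Qed.

End ConstantType.

(** * Proper discontinuity implies constant type *)

Section VaryingType.
Variables (R : realType) (k l : nat).
Hypotheses (k_gt1 : (1 < k)%N) (l_gt0 : (0 < l)%N).
Local Notation C := (CC R).
Local Notation ambient := (ambient R k l).
Local Notation param := (param R k l).
Local Notation act := (act (R := R) (k := k) (l := l)).
Implicit Types (s t : param).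

Lemma nbhs_forall_seq (T : eqType) (E : topologicalType) (r : seq T) (p : E) (A : T -> set E) :
  (forall x, x \in r -> nbhs p (A x)) -> nbhs p [set q | forall x, x \in r -> A x q].
Proof.
elim: r => [|x r IHr] h; first by apply: filterS filterT => q _ x.
have h1 : nbhs p [set q | forall y, y \in r -> A y q].
  by apply: IHr => y yr; apply: h; rewrite inE yr orbT.
apply: filterS2 (h x (mem_head _ _)) h1 => q Aq rq y.
by rewrite inE => /orP[/eqP->|]; [|exact: rq].
Qed.

Lemma nbhs_lt (E : topologicalType) (p : E) (f : E -> R) (c : R) :
  {for p, continuous f} -> f p < c -> nbhs p [set q | f q < c].
Proof. by move=> cf fc; exact: cf (lt_nbhsl fc). Qed.

Lemma nbhs_gt (E : topologicalType) (p : E) (f : E -> R) (c : R) :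
  {for p, continuous f} -> c < f p -> nbhs p [set q | c < f q].
Proof. by move=> cf fc; exact: cf (lt_nbhsr fc). Qed.

Lemma continuous_param_lam t : {for t, continuous (fun s : param => cabs s.1.1)}.
Proof.
apply: (@continuous_comp _ _ _ (fun s : param => s.1.1) (@cabs R)).
  apply: differentiable_continuous.
  apply: (differentiable_comp (g := fst)); first exact: differentiable_fst.
  exact: differentiable_fst.
exact: continuous_cabs.
Qed.

Lemma size_lower_part lam (Q : {poly C}) e n : (size Q <= l * k)%N ->
  (size (lower_part k lam Q e n) <= l * k ^ n)%N.
Proof.
move=> sQ; apply: leq_trans (size_sum _ _ _) _.
apply/bigmax_leqP => i _; apply: leq_trans (size_scale_leq _ _) _.
apply: leq_trans (size_comp_poly_leq _ _) _.
rewrite size_polyXn /=.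
have lk0 : (0 < l * k)%N by rewrite muln_gt0 l_gt0 ltnW.
have sP : ((size (twist_diff Q (e i))).-1 < l * k)%N.
  have := leq_trans (size_twist_diff Q (e i)) sQ.
  by case: size => [|m].
apply: (@leq_ltn_trans ((l * k).-1 * k ^ i)); first by rewrite leq_mul2r -ltnS (prednK lk0) sP orbT.
apply: (@leq_trans (l * k * k ^ i)).
  by rewrite ltn_pmul2r ?expn_gt0 ?(ltnW k_gt1)// prednK.
by rewrite -mulnA -expnS leq_mul2l leq_exp2l// ltn_ord orbT.
Qed.

(** The terms of lower index have degree below [l k^n], so they do not reach this coefficient. *)
Lemma coef_displacement lam (Q : {poly C}) e n m : (size Q <= l * k)%N -> (l <= m)%N ->
  (displacement k lam Q e n)`_(m * k ^ n) = (twist_diff Q (e n))`_m.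
Proof.
move=> sQ lm; have kn : (0 < k ^ n)%N by rewrite expn_gt0 ltnW.
rewrite displacementE coefD coef_comp_poly_Xn// dvdn_mull// mulnK//.
have /leq_sizeP -> := size_lower_part lam e n sQ; first by rewrite add0r.
by rewrite leq_mul2r lm orbT.
Qed.

Lemma size_displacement lam (Q : {poly C}) e n : (size Q <= l * k)%N ->
  (size (displacement k lam Q e n) <= (l * k * k ^ n).+1)%N.
Proof.
move=> sQ; rewrite displacementE; apply: leq_trans (size_polyD _ _) _.
rewrite geq_max; apply/andP; split.
  apply: leq_trans (size_lower_part _ _ _ sQ) _; apply: leqW.
  by rewrite leq_mul2r leq_pmulr ?orbT// ltnW.
apply: leq_trans (size_comp_poly_leq _ _) _; rewrite size_polyXn ltnS leq_mul2r.
by have := leq_trans (size_twist_diff Q (e n)) sQ;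
   case: (size _) => [|m] /= h; rewrite ?(ltnW h) orbT.
Qed.

Lemma switch_level (G : nat -> Prop) N0 : G N0 ->
  (exists2 n, (N0 <= n)%N & ~ G n) -> exists n, [/\ (N0 <= n)%N, G n & ~ G n.+1].
Proof.
move=> G0 [n N0n nG]; apply: contrapT => h; apply: nG.
rewrite -(subnKC N0n); elim: (n - N0)%N => [|i IHi]; first by rewrite addn0.
rewrite addnS; apply: contrapT => nG; apply: h; exists (N0 + i)%N.
by split=> //; rewrite leq_addr.
Qed.

(* [angle d n * k ^ (n + 1)] is [k / d], so the translation by [angle d n]     *)
(* kills exactly the terms of index [n] whose exponent is divisible by [d].   *)
Definition angle d n : rat := (k %/ d)%:R / k%:R ^+ n.+1.

(* The last level at which the [n0]-th term dominates up to radius 128 is     *)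
(* forced to have a root not far outside, or it would not be the last.       *)
Lemma root_near t0 d n0 : (d %| k)%N -> (1 < d)%N -> t0.1.1 != 0 ->
  top_nmult d (Qpoly t0.2) n0 ->
  exists2 r2 : R, 2 < r2 & forall N0, nbhs t0 [set t |
    ~ top_nmult d (Qpoly t.2) n0 ->
    exists n y, [/\ (N0 <= n)%N,
      root (displacement k t.1.1 (Qpoly t.2) (rotation R k (angle d n)) n) y,
      2 <= cabs y & cabs y <= r2]].
Proof.
move=> dk d1 l0 [Q0 dn0 max0].
have lk0 : (0 < l * k)%N by rewrite muln_gt0 l_gt0 ltnW.
have lkR : (1 : R) <= (l * k)%:R by rewrite ler1n.
have kq : (k%:R : rat) != 0 by rewrite pnatr_eq0 -lt0n ltnW.
pose c := (k %/ d)%N.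
have cE n : angle d n * k%:R ^+ n.+1 = (c%:Z)%:~R :> rat.
  by rewrite /angle divfK// expf_neq0.
have kc m : (k %| m%:Z * c%:Z)%Z = (d %| m)%N.
  rewrite dvdzE abszM !absz_nat -{1}(divnK dk) -/c mulnC dvdn_pmul2r//.
  by rewrite /c divn_gt0 ?(ltnW d1)// dvdn_leq// ltnW.
pose om m := root_of_unity R k (- (m%:Z * c%:Z)).
have omE n m : rotation R k (angle d n) n ^+ m = om m.
  exact: rotation_root_of_unity.
have om1 m : (d %| m)%N -> om m = 1.
  by move=> dm; rewrite /om root_of_unity_eq1// rpredN kc.
have [dlt dlt0 dltP] := root_of_unity_gap R k_gt1.
have omgap m : ~~ (d %| m)%N -> dlt <= cabs (1 - om m).
  by move=> dm; apply: dltP; rewrite rpredN kc.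
have om2 m : cabs (1 - om m) <= 2.
  apply: le_trans (cabsD _ _) _; rewrite cabsN cabs1 -(omE 0%N) cabsX cabs_rotation.
  by rewrite expr1n.
pose P t m := (Qpoly t.2)`_m * (1 - om m).
have PE t n m : (twist_diff (Qpoly t.2) (rotation R k (angle d n) n))`_m = P t m.
  by rewrite coef_twist_diff omE.
pose L := cabs t0.1.1 + 1.
have L1 : 1 <= L by rewrite lerDr cabs_ge0.
pose B := \sum_(m < l * k) (cabs (Qpoly t0.2)`_m + 1).
pose b0 := cabs (Qpoly t0.2)`_n0 / 2.
have b00 : 0 < b0 by rewrite divr_gt0// cabs_gt0.
pose beta := b0 * dlt.
have beta0 : 0 < beta by rewrite mulr_gt0.
have rho1 : (1 : R) < 4 by rewrite ltr1n.
have [J JP] := dominant_term k_gt1 l_gt0 B rho1 L1 beta0.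
(* Raised to the power [(m - n0) k^n], this absorbs the factor [2^D] of [root_in_annulus], the
   constant [4 * 8 l k], and the power of 128 from the failure of dominance at level [n + 1]. *)
pose r2 : R := 2 ^+ (l * k) * (32 * (l * k)%:R) * 128 ^+ k.
have r2big : 256 <= r2.
  have h1 : 2 <= 2 ^+ (l * k) :> R by rewrite -[leLHS]expr1 ler_weXn2l// ler1n.
  have h2 : 128 <= 128 ^+ k :> R by rewrite -[leLHS]expr1 ler_weXn2l ?ler1n// ltnW.
  have h3 : 64 <= 2 ^+ (l * k) * (32 * (l * k)%:R) :> R.
    by rewrite -[64]/((2 * 32)%:R) natrM; apply: ler_pM => //; lra.
  apply: le_trans (_ : 64 * 128 <= _); first lra.
  by apply: ler_pM.
exists r2; first lra.
move=> N0; pose N1 := maxn J N0.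
(* Dominance of the exponent [n0] over the higher ones at level [n], up to radius [128 = 32 * 4],
   the outer circle for [root_in_annulus] with [r = 4]. *)
pose G t n := forall m, (n0 < m)%N ->
  8 * (l * k)%:R * (cabs (P t m) * 128 ^+ ((m - n0) * k ^ n)) <= cabs (P t n0).
have nl : nbhs t0 [set t : param | cabs t.1.1 < L].
  by apply: nbhs_lt; [exact: continuous_param_lam | rewrite ltrDl].
have nB : nbhs t0 [set t : param | forall m, m \in iota 0 (l * k) ->
    cabs (Qpoly t.2)`_m < cabs (Qpoly t0.2)`_m + 1].
  apply: (nbhs_forall_seq (A := fun m =>
    [set t : param | cabs (Qpoly t.2)`_m < cabs (Qpoly t0.2)`_m + 1])).
  by move=> m _; apply: nbhs_lt; [exact: continuous_coef | rewrite ltrDl].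
have nb : nbhs t0 [set t : param | b0 < cabs (Qpoly t.2)`_n0].
  apply: nbhs_gt; first exact: continuous_coef.
  by rewrite /b0 ltr_pdivrMr// ltr_pMr ?cabs_gt0// ltr1n.
(* At [t0] these higher coefficients vanish, so near [t0] they are small enough for dominance at the
   prescribed level [N1]. *)
have nG : nbhs t0 [set t : param | forall m, m \in iota 0 (l * k) -> ~~ (d %| m)%N -> (n0 < m)%N ->
    8 * (l * k)%:R * (cabs (Qpoly t.2)`_m * 2 * 128 ^+ ((m - n0) * k ^ N1)) < beta].
  apply: (nbhs_forall_seq (A := fun m => [set t : param | ~~ (d %| m)%N -> (n0 < m)%N ->
    8 * (l * k)%:R * (cabs (Qpoly t.2)`_m * 2 * 128 ^+ ((m - n0) * k ^ N1)) < beta])).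
  move=> m _; have [dm|dm] := boolP (d %| m)%N; first by apply: filterS filterT.
  have [n0m|mn0] := ltnP n0 m; last by apply: filterS filterT.
  have Qm : (Qpoly t0.2)`_m = 0.
    by apply/eqP; apply: contraTT n0m => Qm; rewrite -leqNgt max0.
  pose K : R := 8 * (l * k)%:R * (2 * 128 ^+ ((m - n0) * k ^ N1)).
  have K0 : 0 < K by rewrite !mulr_gt0 ?exprn_gt0//; lra.
  have h : nbhs t0 [set t : param | cabs (Qpoly t.2)`_m < beta / K].
    by apply: nbhs_lt; [exact: continuous_coef | rewrite Qm cabs0 divr_gt0].
  apply: filterS h => t /= h _ _; rewrite ltr_pdivlMr// in h.
  by apply: le_lt_trans h; rewrite /K le_eqVlt; apply/orP; left; apply/eqP; ring.
apply: filterS (filterI (filterI nl nB) (filterI nb nG)) => t /= [[tl tB] [tb tG]] ntop.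
set Q := Qpoly t.2 in tB tb tG ntop *; set lam := t.1.1 in tl *.
have QB m : cabs Q`_m <= B.
  have Bge j : j \in iota 0 (l * k) -> cabs (Qpoly t0.2)`_j + 1 <= B.
    rewrite mem_iota add0n => jl; rewrite /B (bigD1 (Ordinal (jl : (j < l * k)%N)))//= lerDl.
    by rewrite sumr_ge0// => i _; rewrite addr_ge0 ?cabs_ge0.
  have [Qm|Qm] := eqVneq Q`_m 0.
    rewrite Qm cabs0; apply: le_trans (Bge 0%N _); first by rewrite addr_ge0 ?cabs_ge0.
    by rewrite mem_iota.
  have ml : m \in iota 0 (l * k) by rewrite mem_iota; have /andP[] := Qpoly_range Qm.
  exact: le_trans (ltW (tB m ml)) (Bge m ml).
have Pn0 : beta <= cabs (P t n0).
  by rewrite cabsM; apply: ler_pM; [exact: ltW | exact: ltW | exact: ltW | exact: omgap].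
have P0 : 0 < cabs (P t n0) by lra.
have GN1 : G t N1.
  move=> m n0m; have [dm|dm] := boolP (d %| m)%N.
    by rewrite /P om1// subrr mulr0 cabs0 mul0r mulr0 cabs_ge0.
  have [Qm|Qm] := eqVneq Q`_m 0.
    by rewrite /P -/Q Qm mul0r cabs0 mul0r mulr0 cabs_ge0.
  have ml : m \in iota 0 (l * k) by rewrite mem_iota; have /andP[] := Qpoly_range Qm.
  apply: le_trans Pn0; apply: le_trans (ltW (tG m ml dm n0m)).
  rewrite ler_wpM2l ?mulr_ge0 ?ler0n// ler_wpM2r ?exprn_ge0//.
  by rewrite /P cabsM ler_wpM2l ?cabs_ge0.
have [m0 [n0m0 dm0 Qm0]] : exists m, [/\ (n0 < m)%N, ~~ (d %| m)%N & Q`_m != 0].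
  apply: contrapT => h; apply: ntop; split=> //.
    by rewrite -cabs_gt0; lra.
  move=> m Qm dm; rewrite leqNgt; apply/negP => n0m; apply: h.
  by exists m.
(* However small, the nonzero coefficient at [m0 > n0] wins at radius 128 once [n] is large. *)
have nGbig : exists2 n, (N1 <= n)%N & ~ G t n.
  have Pm0 : 0 < cabs (P t m0).
    by rewrite cabsM mulr_gt0 ?cabs_gt0//; rewrite -cabs_gt0; have := omgap _ dm0; lra.
  have [J' J'P] := double_exp_growth k_gt1 (cabs (P t n0) / cabs (P t m0)) 
    (rho := 128) (L := 1) (ltr1n _ _) (lexx _).
  exists (maxn N1 J').+1; first by rewrite leqW// leq_maxl.
  move=> /(_ m0 n0m0); apply/negP; rewrite -ltNge.
  have := J'P (maxn N1 J').+1 (leqW (leq_maxr _ _)); set n := maxn N1 J'.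
  rewrite expr1n mulr1 /= => h.
  have h1 : cabs (P t n0) / cabs (P t m0) <= 128 ^+ ((m0 - n0) * k ^ n.+1).
    apply: le_trans (_ : cabs (P t n0) / cabs (P t m0) * n.+2%:R <= _).
      by rewrite ler_peMr ?divr_ge0 ?cabs_ge0// ler1n.
    apply: (le_trans h); rewrite ler_weXn2l ?ler1n//.
    apply: (@leq_trans (k ^ n.+1)); first by rewrite leq_exp2l.
    by rewrite leq_pmull// subn_gt0.
  rewrite ler_pdivrMr// mulrC in h1.
  apply: (@lt_le_trans _ _ (8 * cabs (P t n0))); first lra.
  by rewrite -mulrA ler_wpM2l//; set X := cabs _ * _ in h1 *; nra.
have [n [N1n Gn nGn]] := switch_level GN1 nGbig.
have [m n0m mbig] : exists2 m, (n0 < m)%N &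
    cabs (P t n0) < 8 * (l * k)%:R * (cabs (P t m) * 128 ^+ ((m - n0) * k ^ n.+1)).
  apply: contrapT => h; apply: nGn => m n0m; rewrite leNgt; apply/negP => ?.
  by apply: h; exists m.
have /andP[ln0 _] := Qpoly_range Q0.
have Jn : (J <= n)%N by apply: leq_trans N1n; rewrite leq_maxl.
set e := rotation R k (angle d n).
have Pne : P t n0 != 0 by rewrite -cabs_gt0.
have e1 i : cabs (e i) = 1 by exact: cabs_rotation.
have [||||y [ry y1 y2]] := @root_in_annulus R (displacement k lam Q e n) (P t n0)
    (n0 * k ^ n) (m * k ^ n) (l * k * k ^ n) 4 r2 Pne _ _ (size_displacement _ _ _ (size_Qpoly _)).
- by rewrite ltr0n.
- lra.
- move=> y y4; have y4' : 4 <= cabs y by lra.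
  have y128 : cabs y <= 128 by lra.
  have := JP n lam Q e n0 y Jn (size_Qpoly _) QB e1 (ltW tl) y4' ln0.
  rewrite /= !PE; apply=> // j n0j.
  rewrite PE -[X in (X * k ^ n)%N](subnK (ltnW n0j)) mulnDl exprD !mulrA.
  rewrite ler_wpM2r ?exprn_ge0 ?cabs_ge0//.
  apply: le_trans (Gn _ n0j); rewrite -!mulrA !ler_wpM2l ?cabs_ge0//; try lra.
  by rewrite lerXn2r ?nnegrE ?cabs_ge0.
- rewrite coef_displacement ?size_Qpoly//; last by rewrite (leq_trans ln0)// ltnW.
  have mE : r2 ^+ (m * k ^ n) = r2 ^+ ((m - n0) * k ^ n) * r2 ^+ (n0 * k ^ n).
    by rewrite -exprD -mulnDl subnK// ltnW.
  rewrite PE mE mulrA.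
  have r20 : 0 < r2 by lra.
  rewrite ltr_pM2r ?exprn_gt0//.
  set M := ((m - n0) * k ^ n)%N.
  have M0 : (0 < M)%N by rewrite muln_gt0 subn_gt0 n0m expn_gt0 ltnW.
  have kM : (k ^ n <= M)%N by rewrite leq_pmull// subn_gt0.
  have r2M : 2 ^+ (l * k * k ^ n) * (32 * (l * k)%:R) * 128 ^+ ((m - n0) * k ^ n.+1) <= r2 ^+ M.
    rewrite /r2 !exprMn -!exprM; apply: ler_pM; rewrite ?mulr_ge0 ?exprn_ge0//.
    - apply: ler_pM; rewrite ?mulr_ge0 ?exprn_ge0//.
        by rewrite ler_weXn2l ?ler1n// leq_mul2l kM orbT.
      rewrite -exprMn -[leLHS]expr1 ler_weXn2l//.
      by apply: mulr_ege1 => //; rewrite ler1n.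
    - by rewrite expnS mulnCA ler_weXn2l ?ler1n.
  apply: lt_le_trans (_ : cabs (P t m) * (2 ^+ (l * k * k ^ n) *
      (32 * (l * k)%:R) * 128 ^+ ((m - n0) * k ^ n.+1)) <= _); last first.
    by rewrite ler_wpM2l ?cabs_ge0.
  have -> : cabs (P t m) * (2 ^+ (l * k * k ^ n) * (32 * (l * k)%:R) *
      128 ^+ ((m - n0) * k ^ n.+1)) =
    2 ^+ (l * k * k ^ n) * 4 * (8 * (l * k)%:R *
      (cabs (P t m) * 128 ^+ ((m - n0) * k ^ n.+1))) by ring.
  by rewrite ltr_pM2l// mulr_gt0// exprn_gt0.
exists n, y; split=> //; last by lra.
by apply: leq_trans N1n; rewrite leq_maxr.
Qed.

End VaryingType.

Section LocallyConstant.
Variables (R : realType) (k l : nat).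
Hypotheses (k_gt1 : (1 < k)%N) (l_gt0 : (0 < l)%N).
Local Notation C := (CC R).
Local Notation ambient := (ambient R k l).
Local Notation param := (param R k l).
Local Notation act := (act (R := R) (k := k) (l := l)).
Implicit Types (s t : param).

Lemma root_returns t d n (y : C) : (d %| k)%N -> t.1.1 != 0 -> y != 0 ->
  root (displacement k t.1.1 (Qpoly t.2) (rotation R k (angle k d n)) n) y ->
  exists w : C, [/\ complex.Re w = - ln (cabs y), `|complex.Im w| <= pi &
    act (0, angle k d n) ((0, w), t) = ((0, w + ratr (angle k d n) * tpi R), t)].
Proof.
move=> dk l0 y0 ry.
have kq : (k%:R : rat) != 0 by rewrite pnatr_eq0 -lt0n ltnW.
have an : angle k d n * k%:R ^+ n.+1 \is a Num.int.
  by rewrite /angle divfK ?expf_neq0// natr_int.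
have [w0 [w0y Rw0 Iw0]] := cexp_surj y0.
exists (- w0); split.
- by rewrite Re_oppC Rw0.
- by case: w0 Iw0 {w0y Rw0} => a b /=; rewrite normrN.
- set x := (0, angle k d n).
  have e : t.1.1 ^+ n.+1 * ((act x ((0, - w0), t)).1.1 - 0) =
      (displacement k t.1.1 (Qpoly t.2) (rotation R k (angle k d n)) n).[cexp (- - w0)].
    exact: (@act_translation R k l k_gt1 (angle k d n) n ((0, - w0), t) l0 an).
  move/eqP: e; rewrite opprK w0y (rootP ry) subr0 mulf_eq0 expf_eq0 (negbTE l0) andbF orFb.
  move=> /eqP e0.
  have -> : act x ((0, - w0), t) =
     (((act x ((0, - w0), t)).1.1, base_move k x (- w0)), t) by [].
  by rewrite e0 /base_move /x expr0z mul1r.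
Qed.

Lemma compact_box (a b c : R) (S : set param) : compact S ->
  compact [set p : ambient | [/\ p.1.1 = 0, a <= complex.Re p.1.2 <= b,
    `|complex.Im p.1.2| <= c & S p.2]].
Proof.
move=> cS.
pose mkC (v : R * R) : C := (v.1 +i* v.2)%C.
have cC : compact (mkC @` (`[a, b] `*` `[- c, c])).
  apply: continuous_compact; last by apply: compact_setX; exact: segment_compact.
  exact/continuous_subspaceT/continuous_mkC.
have := compact_setX (compact_setX (@compact_set1 C 0) cC) cS.
congr compact; apply/seteqP; split=> [[[z w] s] [[/= -> [[x y] [/= xab yc] <-]] Ss]|].
  rewrite /= in_itv/= in xab; rewrite /= in_itv/= -ler_norml in yc.
  by split.
move=> [[z w] s] /= [-> wab wc Ss]; split=> //; split=> //=.
exists (complex.Re w, complex.Im w); last by case: w {wab wc}.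
split=> /=; first by rewrite in_itv.
by rewrite in_itv/= -ler_norml.
Qed.

(** Otherwise parameters tending to [t0] have roots at levels [n >= j] in one fixed annulus. The
    corresponding points return to a fixed compact set under nonzero translations tending to 0, that
    is, under infinitely many group elements. *)
Lemma top_nmult_locally_constant (T : set param) t0 d n0 :
  T `<=` @setAB R k l -> prop_discontinuous (ZZk k) act (fibered_over T) ->
  T t0 -> (d %| k)%N -> (1 < d)%N -> top_nmult d (Qpoly t0.2) n0 ->
  nbhs t0 [set t | T t -> top_nmult d (Qpoly t.2) n0].
Proof.
move=> TAB pd Tt0 dk d1 tn0; apply: contrapT => nn.
have lam0 t : T t -> t.1.1 != 0 by move=> /TAB[[]].
have [r2 r2_gt2 roots] := root_near k_gt1 l_gt0 dk d1 (lam0 _ Tt0) tn0.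
have pick j : {u : param * nat * C | [/\ T u.1.1, small_ball t0 j u.1.1, (j <= u.1.2)%N,
    root (displacement k u.1.1.1.1 (Qpoly u.1.1.2) (rotation R k (angle k d u.1.2)) u.1.2) u.2 &
    2 <= cabs u.2 <= r2]}.
  apply: cid; apply: contrapT => h; apply: nn.
  apply: filterS (filterI (roots j) (nbhs_small_ball t0 j)) => t [rt bt] Tt.
  apply: contrapT => /rt[n [y [jn ry y1 y2]]]; apply: h.
  by exists ((t, n), y); split=> //=; rewrite y1.
pose u j := sval (pick j); have uP j := svalP (pick j).
pose S := range (fun j => (u j).1.1) `|` [set t0].
have cS : compact S.
  by apply: compact_seq_cvg; apply: small_ball_cvg => j; have [] := uP j.
have ST : S `<=` T by move=> t [[j _ <-]|->] //; have [] := uP j.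
(* The starting points have imaginary part at most [pi] in modulus, and an angle at most 1 adds at
   most [2 pi]. *)
pose K := [set p : ambient | [/\ p.1.1 = 0, - ln r2 <= complex.Re p.1.2 <= - ln 2,
    `|complex.Im p.1.2| <= 3 * pi & S p.2]].
have cK : compact K by exact: compact_box.
have KT : K `<=` fibered_over T.
  move=> p [_ /andP[_ p2] _ Sp]; split; last exact: ST.
  rewrite /half_plane/=; apply: le_lt_trans p2 _.
  by rewrite oppr_lt0 ln_gt0// ltr1n.
have /finite_seqP[r rE] := pd K KT cK.
have c0 : (0 < k %/ d)%N by rewrite divn_gt0 ?(ltnW d1)// dvdn_leq// ltnW.
have kR : (0 : R) < k%:R by rewrite ltr0n ltnW.
have angE n : (ratr (angle k d n) : R) = (k %/ d)%:R / k%:R ^+ n.+1.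
  by rewrite /angle rmorphM/= fmorphV rmorphXn/= !ratr_nat.
have ang0 n : 0 < (ratr (angle k d n) : R).
  by rewrite angE divr_gt0 ?exprn_gt0// ltr0n.
have angle_le n : (ratr (angle k d n) : R) * k%:R ^+ n <= 1.
  rewrite angE mulrAC ler_pdivrMr ?exprn_gt0// mul1r exprS ler_pM2r ?exprn_gt0//.
  by rewrite ler_nat leq_div.
have inr j : (0, angle k d (u j).1.2) \in r.
  suff : [set x | ZZk k x /\ (act x @` K) `&` K !=set0] (0, angle k d (u j).1.2) by rewrite rE.
  have [Tu _ _ ru /andP[u1 u2]] := uP j.
  set n := (u j).1.2 in ru *; set t := (u j).1.1 in Tu ru *; set y := (u j).2 in ru u1 u2 *.
  have y0 : y != 0 by rewrite -cabs_gt0 (lt_le_trans _ u1).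
  have [w [Rw Iw aw]] := root_returns dk (lam0 _ Tu) y0 ru.
  have kq : (k%:R : rat) != 0 by rewrite pnatr_eq0 -lt0n ltnW.
  have St : S t by left; exists j.
  have Rb : - ln r2 <= complex.Re w <= - ln 2.
    have cy0 : 0 < cabs y by rewrite cabs_gt0.
    have r20 : 0 < r2 := lt_le_trans cy0 u2.
    by rewrite Rw !lerN2 !ler_ln ?posrE ?u1 ?u2.
  have pi0 := pi_ge0 R.
  split; first by exists n.+1; rewrite /= /angle divfK ?expf_neq0// natr_int.
  exists (act (0, angle k d n) ((0, w), t)); split.
    by exists ((0, w), t) => //; split=> //=; lra.
  rewrite aw; split=> //=; rewrite ratrC tpiM.
    by rewrite Re_addC/= addr0.
  have -> : complex.Im (w + (0 +i* (ratr (angle k d n) * (2 * pi)))%C) =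
    complex.Im w + ratr (angle k d n) * (2 * pi) by case: (w).
  apply: le_trans (ler_normD _ _) _.
  have := ger0_norm (mulr_ge0 (ltW (ang0 n)) (mulr_ge0 (ler0n R 2) pi0)) => ->.
  have a1 : (ratr (angle k d n) : R) <= 1.
    apply: le_trans (angle_le n); rewrite ler_peMr ?(ltW (ang0 n))//.
    by rewrite exprn_ege1// ler1n ltnW.
  have : ratr (angle k d n) * (2 * pi) <= 1 * (2 * pi) :> R by rewrite ler_wpM2r ?mulr_ge0.
  by move: Iw; lra.
(* A common lower bound of the positive translations in the finite list, contradicted by the angle
   at level [n], which is at most [k^-n]. *)
have [||e e0 eP] := @finite_pos R (int * rat)%type r
    (fun x e => 0 < (ratr x.2 : R) -> e <= ratr x.2).
- by move=> x a b ba h /h; exact: le_trans.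
- move=> x _; have [x0|x0] := ltP 0 (ratr x.2 : R); first by exists (ratr x.2).
  by exists 1.
pose j := Num.truncn e^-1.
have [_ _ jn _ _] := uP j; set n := (u j).1.2 in jn.
have en : e <= (ratr (angle k d n) : R) by apply: (eP _ (inr j)); exact: ang0.
have kn : e^-1 < k%:R ^+ n.
  apply: lt_le_trans (truncnS_gt _) _; rewrite -/j -natrX ler_nat.
  by apply: leq_trans (_ : n.+1 <= _)%N; [rewrite ltnS | exact: ltn_expl].
have := angle_le n; apply/negP; rewrite -ltNge.
apply: lt_le_trans (_ : e * k%:R ^+ n <= _); last by rewrite ler_wpM2r// exprn_ge0// ltW.
by rewrite -ltr_pdivrMl// mulr1.
Qed.

Lemma prop_discontinuous_constant_type (T : set param) :
  T `<=` @setAB R k l -> connected T ->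
  prop_discontinuous (ZZk k) act (fibered_over T) ->
  forall s t, T s -> T t -> type_of s = type_of t.
Proof.
move=> TAB cT pd s t Ts Tt.
have TB t' : T t' -> setB t'.2 by move=> /TAB[].
apply/(type_of_eqP k_gt1 (TB _ Ts) (TB _ Tt)) => d n dk d1 sn.
(* This set is open and closed in [T]: near a point outside it, a different top exponent is locally
   constant. *)
pose B := [set t' | T t' /\ top_nmult d (Qpoly t'.2) n].
suff BT : B = T by move: Tt; rewrite -BT => -[].
apply: cT; first by exists s.
- exists (interior [set t' | T t' -> top_nmult d (Qpoly t'.2) n]).
    exact: open_interior.
  apply/seteqP; split=> t' [Tt' h]; split=> //.
    exact: top_nmult_locally_constant.
  exact: (interior_subset h).
- exists (~` interior [set t' | T t' -> ~ top_nmult d (Qpoly t'.2) n]).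
    exact/open_closedC/open_interior.
  apply/seteqP; split=> t' [Tt' h]; split=> //.
    by move=> /interior_subset; apply.
  apply: contrapT => nh; apply: h.
  have [n' tn'] := setB_top_nmult (TB _ Tt') dk d1.
  have := top_nmult_locally_constant TAB pd Tt' dk d1 tn'.
  apply: filterS => t'' h'' /h'' tn'' tn; apply: nh.
  by rewrite (top_nmult_uniq tn tn'').
Qed.

End LocallyConstant.

(** * The action, the discontinuity criterion and the quotient together *)

Lemma open_half_plane (R : realType) : open (@half_plane R).
Proof.
rewrite openE => u hu.
have cw : {for u, continuous (fun v : CC R * CC R => complex.Re v.2)}.
  apply: (@continuous_comp _ _ _ (fun v : CC R * CC R => v.2) (fun w : CC R => complex.Re w)).
    exact: cvg_snd.
  exact: continuous_Re.
exact: nbhs_lt.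
Qed.

Theorem theorem8p16 (R : realType) (k l : nat)
    (k_ge2 : (2 <= k)%N) (l_ge1 : (1 <= l)%N) :
  exists act : int * rat -> ambient R k l -> ambient R k l,
    [/\ is_ZZk_action k (fibered_over (@setAB R k l)) act,
        forall x, ZZk k x -> holo_on (fibered_over (@setAB R k l)) (act x),
        forall x p, ZZk k x -> fibered_over (@setAB R k l) p ->
          (act x p).2 = p.2 &
        forall p, fibered_over (@setAB R k l) p ->
          act (0, 1) p = g_gamma p /\ act (1, 0) p = g_auto p] /\
    forall T : cspace (param R k l), subspace_AB T -> connected (pts T) ->
      let Y : cspace (ambient R k l) := prod_space (@half_plane R) T in
      (prop_discontinuous (ZZk k) act (pts Y) <->
         (forall s t, pts T s -> pts T t -> type_of s = type_of t)) /\
      (prop_discontinuous (ZZk k) act (pts Y) ->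
         forall (X : topologicalType) (pr : ambient R k l -> X),
           is_orbit_space (ZZk k) act (pts Y) pr ->
           hausdorff_space X /\ fibers_smoothly T Y pr).
Proof.
have lam0 p : fibered_over (@setAB R k l) p -> p.2.1.1 != 0 by move=> [_ [[]]].
exists (@act R k l); split.
  split.
  - split.
    + by move=> x p _; exact: act_fibered.
    + by move=> p /lam0; exact: act1.
    + by move=> x y p zx zy [_ [sA _]]; exact: actM.
  - move=> x zx p /lam0 l0; have [F hF eF] := act_holo_at k_ge2 zx l0.
    by exists F => //; apply: filterS eF.
  - by [].
  - by move=> p /lam0 l0; split; [exact: act_g_gamma | exact: act_g_auto].
move=> T [_ TAB] cT Y.
have {}TAB : pts T `<=` @setAB R k l by move=> t /TAB[].
have Ylam p : pts Y p -> p.2.1.1 != 0 by move=> [_ /TAB[[]]].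
split.
  split; first exact: prop_discontinuous_constant_type.
  by move=> cst; exact: constant_type_prop_discontinuous.
move=> pd X pr orb.
have act_in x p : ZZk k x -> pts Y p -> pts Y (act x p).
  by move=> _; exact: act_fibered.
have act_c x p : ZZk k x -> pts Y p -> {for p, continuous (@act R k l x)}.
  by move=> zx /Ylam; exact: act_continuous.
have act_fr x p : ZZk k x -> pts Y p -> act x p = p -> forall q, pts Y q -> act x q = q.
  move=> _ [hp _] /(act_free k_ge2 hp) -> q /Ylam; exact: act1.
split; first exact: (orbit_space_hausdorff act_in act_c pd orb).
exact: (orbit_space_fibers_smoothly (@open_half_plane R) act_in act_c pd act_fr orb).
Qed.
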